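(* Let $k\ge 1$ be an integer and let $G$ be a graph on $n$ vertices such that its edge ideal $I(G)$ is $k$-steps linear. Then \[ \operatorname{reg}(I(G)) \leq \log_{\frac{k+4}{2}}\left( \frac{(n - 1) \ln \left( \frac{k+4}{2}\right)}{k+1} + \frac{2}{k+4} \right) +3 . \]
   Context: All graphs are finite and simple. Let $K$ be a fixed field and let $S$ be the polynomial ring over $K$ whose variables are the vertices of $G$ (standard graded). The edge ideal of $G$ is $I(G) = (xy : (x,y) \text{ is an edge of } G)\subset S$. The Castelnuovo–Mumford regularity of a graded $S$-module $M$ is $\operatorname{reg}(M)=\max\{\,j-m : \operatorname{Tor}^S_m(M,K)_j\neq 0\,\}$; by convention $\operatorname{reg}(I(G))=2$ when $G$ has no edges. The ideal $I(G)$ is called $k$-steps linear if $\operatorname{Tor}_i^S(I(G),K)_j=0$ for all $1\le i\le k$ and all $j\ne i+2$. *)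

(* Defs.v *)
From HB Require Import structures.
From mathcomp Require Import all_boot all_order all_algebra.
From mathcomp Require Import mpoly.
From mathcomp Require Import reals exp.

Set Implicit Arguments.
Unset Strict Implicit.
Unset Printing Implicit Defensive.

Import Order.TTheory GRing.Theory Num.Theory.
Local Open Scope ring_scope.

Definition logb (R : realType) (b x : R) : R := ln x / ln b.

(* Degrees are integers since free modules may be twisted in either direction;
   the zero polynomial is homogeneous of every degree. *)
Definition zhomog (K : fieldType) (n : nat) (d : int) (p : {mpoly K[n]}) : Prop :=
  forall m : 'X_{1..n}, m \in msupp p -> (mdeg m)%:Z = d.

(* A graded resolution of the ideal I by finitely generated graded free modules
   F_i = \bigoplus_a S(- gshift i a), elements of F_i being row vectors:
   ... -> F_1 --(_ *m gdiff 0)--> F_0 --(_ *m gaug)--> I -> 0. *)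
Record graded_free_resolution (K : fieldType) (n : nat)
    (I : {mpoly K[n]} -> Prop) : Type := GradedFreeResolution {
  grank : nat -> nat;
  gshift : forall i, 'I_(grank i) -> int;
  gaug : 'cV[{mpoly K[n]}]_(grank 0);
  gdiff : forall i, 'M[{mpoly K[n]}]_(grank i.+1, grank i);
  gaug_homog : forall a, zhomog (gshift a) (gaug a ord0);
  gdiff_homog : forall i a b, zhomog (gshift a - gshift b) (gdiff i a b);
  gaug_image : forall f : {mpoly K[n]},
    I f <-> exists u : 'rV_(grank 0), (u *m gaug) ord0 ord0 = f;
  gexact0 : forall u : 'rV_(grank 0),
    u *m gaug = 0 <-> exists w : 'rV_(grank 1), u = w *m gdiff 0;
  gexactS : forall i (u : 'rV_(grank i.+1)),
    u *m gdiff i = 0 <-> exists w : 'rV_(grank i.+2), u = w *m gdiff i.+1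
}.

Section Tor.
Variables (K : fieldType) (n : nat) (I : {mpoly K[n]} -> Prop).

Section Reduction.
Variable F : graded_free_resolution I.

(* F_i (x)_S K = K^(grank i), where K = S / (x_1, ..., x_n): the differential is
   obtained by taking constant coefficients. *)
Definition diffK i : 'M[K]_(grank F i.+1, grank F i) :=
  map_mx (fun p : {mpoly K[n]} => p@_(0%MM)) (gdiff F i).

Definition in_degree i (j : int) (v : 'rV[K]_(grank F i)) : Prop :=
  forall a, v ord0 a != 0 -> gshift a = j.

Definition cycle i : 'rV[K]_(grank F i) -> Prop :=
  match i return 'rV[K]_(grank F i) -> Prop with
  | 0 => fun _ => True
  | i'.+1 => fun v => v *m diffK i' = 0
  end.

Definition homology_neq0 i (j : int) : Prop :=
  exists v : 'rV[K]_(grank F i), [/\ in_degree j v, cycle v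
    & ~ exists w : 'rV[K]_(grank F i.+1), in_degree j w /\ v = w *m diffK i].

End Reduction.

(* Tor_i^S(I, K)_j <> 0; this does not depend on the resolution F. *)
Definition tor_neq0 (i : nat) (j : int) : Prop :=
  exists F : graded_free_resolution I, homology_neq0 F i j.

Definition is_max_tor_degree (r : int) : Prop :=
  (exists m j, tor_neq0 m j /\ r = j - m%:Z) /\
  (forall m j, tor_neq0 m j -> j - m%:Z <= r).

End Tor.

Definition edge_ideal (K : fieldType) (n : nat) (e : rel 'I_n)
    (f : {mpoly K[n]}) : Prop :=
  exists c : 'I_n -> 'I_n -> {mpoly K[n]},
    f = \sum_(x < n) \sum_(y < n | e x y) c x y * ('X_x * 'X_y).

(* reg (I(G)) = r; the regularity of the zero ideal is 2 by convention. *)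
Definition edge_ideal_reg (K : fieldType) (n : nat) (e : rel 'I_n) (r : int) : Prop :=
  if [exists x, exists y, e x y] then is_max_tor_degree (@edge_ideal K n e) r
  else r = 2.

Definition steps_linear (K : fieldType) (n : nat) (e : rel 'I_n) (k : nat) : Prop :=
  forall i : nat, (1 <= i <= k)%N -> forall j : int, j <> i%:Z + 2 ->
    ~ tor_neq0 (@edge_ideal K n e) i j.

(* Main.v *)
(** Let H be the complement of G. The groups Tor_i(I(G), K) are computed by the
    Koszul homology of I(G) (balance a resolution against the Koszul complex);
    in squarefree multidegree W this is the reduced cohomology of the clique
    complex of H[W], in degree |W| - i - 2, and the other multidegrees are
    acyclic. So reg(I(G)) = d + 2 for the largest d such that some H[W] has
    cohomology in degree d, and k-step linearity says that every hole (induced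
    cycle of length at least 4) of H has length at least k + 4 = 2 b.

    If cohomology in degree d is present and W is minimal, every neighbourhood
    N(w) in H[W] has cohomology in degree d - 1. By induction on d there is a
    probability distribution mu on W that gives mass at most 1/b to each clique
    and for which the mean number of non-neighbours is at least
    (k + 1) b^(d - 1). For d = 1 take the uniform distribution on a hole. For
    the step let mu_w be such a distribution on N(w): a vertex y outside N[w]
    is adjacent to a clique of N(w) only, H having no induced 4-cycle, so the
    mean number of non-neighbours under mu_w is at least
    (k + 1) b^(d - 2) + (1 - 1/b) |W - N[w]|, and a stationary distribution of
    the Markov chain with transition kernel mu satisfies the claim.
    Choosing w with at least (k + 1) b^(d - 1) non-neighbours and descending to
    N(w) gives n >= 1 + (k + 1) (1 + b + ... + b^(d - 1)), which implies the
    bound since ln b >= 1 - 1/b. *)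

Require Import Defs.
From mathcomp Require Import mpoly.
From mathcomp Require Import all_boot all_order all_algebra reals exp.
From mathcomp Require Import boolp zify ring lra.

Set Implicit Arguments.
Unset Strict Implicit.
Unset Printing Implicit Defensive.

(** * Holes and simplicial vertices *)

Section Graph.
Variables (T : finType) (h : rel T).
Hypotheses (h_sym : symmetric h) (h_irr : irreflexive h).
Implicit Types (x y v : T) (W Q : {set T}) (c q : seq T).

(** Consecutive positions modulo [m], spelled out without modular arithmetic so that [lia] can
    decide the case analyses on holes. *)
Definition cyc_adj m i j :=
  [|| j == i.+1, i == j.+1, (i == 0) && (j == m.-1) | (j == 0) && (i == m.-1)].

Definition hole x0 c := [/\ uniq c, 3 < size c &
  forall i j, i < j < size c -> h (nth x0 c i) (nth x0 c j) = cyc_adj (size c) i j].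

Lemma hole_adj x0 c : hole x0 c ->
  forall i j, i < size c -> j < size c -> i != j ->
  h (nth x0 c i) (nth x0 c j) = cyc_adj (size c) i j.
Proof.
move=> [_ _ hc] i j ic jc ij; case: (ltngtP i j) ij => // [ij|ji] _.
  by rewrite hc // ij.
by rewrite h_sym hc ?ji // /cyc_adj; do !case: eqP.
Qed.

(** Three pairwise consecutive positions would close up to a cycle of length 3, while a hole has
    length at least 4. *)
Lemma hole_clique x0 c Q : hole x0 c -> {in Q &, forall x y, x != y -> h x y} ->
  #|Q :&: [set x in c]| <= 2.
Proof.
move=> hc hQ; rewrite leqNgt; apply/negP => /card_gt2P[x [y [z [[xQ yQ zQ] [xy yz zx]]]]].
move: xQ yQ zQ; rewrite !inE => /andP[xQ xc] /andP[yQ yc] /andP[zQ zc].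
have adj u w : u \in Q -> w \in Q -> u \in c -> w \in c -> u != w ->
    index u c < size c /\ cyc_adj (size c) (index u c) (index w c).
  move=> uQ wQ uc wc uw; rewrite index_mem uc; split=> //.
  rewrite -(hole_adj hc) ?index_mem ?nth_index ?hQ //.
  by apply: contraNneq uw => /(congr1 (nth x0 c)); rewrite !nth_index // => ->.
have [a1 a2] := adj x y xQ yQ xc yc xy; have [b1 b2] := adj y z yQ zQ yc zc yz.
have [c1 c2] := adj z x zQ xQ zc xc zx; case: (hc) => _ m4 _.
move: a2 b2 c2; rewrite /cyc_adj; lia.
Qed.

Lemma hole_degree x0 c w : hole x0 c -> w \in c -> #|[set x in c | h x w]| <= 2.
Proof.
move=> hc wc; set i := index w c; set m := size c.
have im : i < m by rewrite index_mem.
pose a := nth x0 c (if i == 0 then m.-1 else i.-1).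
pose b := nth x0 c (if i == m.-1 then 0 else i.+1).
apply: (@leq_trans #|[set a; b]|); last by rewrite cards2; case: (_ != _).
apply/subset_leq_card/subsetP => x; rewrite !inE => /andP[xc xw].
have jm : index x c < m by rewrite index_mem.
have ij : index x c != i.
  by apply: contraTneq xw => /(congr1 (nth x0 c)); rewrite !nth_index // => ->;
    rewrite h_irr.
have : cyc_adj m (index x c) i by rewrite -(hole_adj hc) // !nth_index.
move=> hj; have [e|e] : index x c = (if i == 0 then m.-1 else i.-1) \/
    index x c = (if i == m.-1 then 0 else i.+1) 
    by move: hj; rewrite /cyc_adj; case: (i =P 0); case: (i =P m.-1); lia.
  by rewrite /a -e nth_index ?eqxx.
by rewrite /b -e nth_index ?eqxx ?orbT.
Qed.

Lemma last_take x q i : i <= size q -> last x (take i q) = nth x (x :: q) i.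
Proof.
move=> iq; rewrite (last_nth x) size_takel //.
by rewrite -[x :: take i q]/(take i.+1 (x :: q)) nth_take.
Qed.

(** A path of least length has no chord: cutting out the part between the ends of a chord would
    shorten it. *)
Lemma shortest_path (g : rel T) x y : connect g x y ->
  exists q, [/\ path g x q, last x q = y, uniq (x :: q) &
    forall i j, i < j < size (x :: q) -> g (nth x (x :: q) i) (nth x (x :: q) j) ->
      j = i.+1].
Proof.
move=> /connectP[q0 q0p q0l].
pose P k := [exists t : k.-tuple T, path g x t && (last x t == y)].
have exP : exists k, P k.
  by exists (size q0); apply/existsP; exists (in_tuple q0); rewrite q0p q0l /=.
case: (ex_minnP exP) => k /existsP[q1 /andP[q1p /eqP q1l]] kmin.
have q1min q' : path g x q' -> last x q' = y -> size q1 <= size q'.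
  move=> p' l'; rewrite size_tuple; apply: kmin; apply/existsP; exists (in_tuple q').
  by rewrite p' l' /=.
case/shortenP: (q1p) (q1l) => q qp qu sub ql.
have qmin q' : path g x q' -> last x q' = y -> size q <= size q'.
  move=> p' l'; apply: leq_trans (q1min q' p' l').
  by apply: uniq_leq_size sub; case/andP: qu.
exists q; split=> // i j /andP[ij jq] gij; apply/eqP; rewrite eqn_leq ij andbT leqNgt.
apply/negP => ij1; move: jq; rewrite /= ltnS => jq.
have jE : drop j.-1 q = nth x (x :: q) j :: drop j q.
  by case: (j) ij jq => // j' _ jq'; rewrite /= (drop_nth x).
(* In [x :: q] indices are shifted by one against [q]: [take i q] ends at vertex [i] and
   [drop j.-1 q] begins at vertex [j], so a chord from [i] to [j] joins the two into a path. *)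
move: (qmin (take i q ++ drop j.-1 q)).
rewrite cat_path last_cat last_take; last by lia.
have qE := cat_take_drop j q.
have : path g x (take j q ++ drop j q) by rewrite qE.
rewrite cat_path last_take // => /andP[_ pj].
have : path g x (take i q ++ drop i q) by rewrite cat_take_drop.
rewrite cat_path => /andP[pi _].
have lq : last (nth x (x :: q) j) (drop j q) = y.
  by rewrite -ql -[in RHS]qE last_cat last_take.
rewrite pi jE /= gij pj lq => /(_ isT erefl).
rewrite size_cat /= size_takel ?size_drop; lia.
Qed.

Definition nbh v W := [set u in W | h u v].
Definition clique Q := [forall x in Q, forall y in Q, (x != y) ==> h x y].

Lemma cliqueP Q : reflect {in Q &, forall x y, x != y -> h x y} (clique Q).
Proof.
apply: (iffP forall_inP) => [hQ x y xQ yQ xy|hQ x xQ].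
  by have /forall_inP/(_ y yQ)/implyP := hQ x xQ; apply.
by apply/forall_inP => y yQ; apply/implyP; exact: hQ.
Qed.

Definition far v W := [set u in W | (u != v) && ~~ h u v].
(** A path from [x] never leaves the component of [x], so the two relations need only be compared
    there. *)
Lemma connect_sub_comp (g g' : rel T) x y :
  (forall u w, connect g x u -> connect g x w -> g u w -> g' u w) ->
  connect g x y -> connect g' x y.
Proof.
move=> gg' /connectP[p]; elim/last_ind: p y => [|p z IHp] y; first by move=> _ ->.
rewrite rcons_path last_rcons => /andP[gp gz] ->.
have gl : connect g x (last x p) by apply/connectP; exists p.
apply: connect_trans (IHp _ gp erefl) _; apply/connect1/gg' => //.
exact: connect_trans gl (connect1 gz).
Qed.

Definition within Q := [rel x y | [&& x \in Q, y \in Q & h x y]].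

Lemma path_within Q x q : path (within Q) x q -> {subset q <= Q}.
Proof.
elim: q x => //= y q IHq x /andP[/and3P[_ yQ _] /IHq qQ] z.
by rewrite inE => /predU1P[->|/qQ].
Qed.

(** A shortest path from [s] to [s'] inside [Q] is induced, and [v] sees only its two ends, so [v]
    closes it to a hole. *)
Lemma hole_of_path v s s' Q : v \notin Q -> s \in Q -> h v s -> h v s' ->
  s != s' -> ~~ h s s' -> {in Q, forall x, x != s -> x != s' -> ~~ h v x} ->
  connect (within Q) s s' ->
  exists q, hole v (v :: q) /\ {subset v :: q <= v |: Q}.
Proof.
move=> vQ sQ vs vs' ss' nss' Qv /shortest_path[q [qp ql qu qi]]; exists (s :: q).
have qQ x : x \in s :: q -> x \in Q.
  by rewrite inE => /predU1P[->|/(path_within qp)].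
(* As [s] and [s'] are distinct and non-adjacent, the path has an inner vertex, and the cycle has at
   least four vertices. *)
have q2 : 1 < size q.
  case: q qp ql {qu qi qQ} => [|y [|//]] /=; first by move=> _ /eqP; rewrite (negPf ss').
  by rewrite andbT => /and3P[_ _ sy] ys; rewrite ys (negPf nss') in sy.
have nthQ i : i <= size q -> nth v (s :: q) i \in Q.
  by move=> iq; apply/qQ/mem_nth.
have nthl : nth v (s :: q) (size q) = s'.
  by rewrite -[size q]/((size (s :: q)).-1) nth_last -ql.
have vnth j : j <= size q -> h v (nth v (s :: q) j) = (j == 0) || (j == size q).
  move=> jq; case: (eqVneq j 0) => [->|j0]; first by rewrite /= vs.
  have [->|jl] := eqVneq j (size q); first by rewrite nthl vs' orbT.
  apply/negP/negP/Qv; rewrite ?nthQ //.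
    by rewrite -[s in _ != s]/(nth v (s :: q) 0) nth_uniq.
  by rewrite -nthl nth_uniq //=.
have inner i j : i < j <= size q -> h (nth v (s :: q) i) (nth v (s :: q) j) = (j == i.+1).
  move=> /andP[ij jq]; apply/idP/eqP => [hij|ji]; last first.
    rewrite ji in jq *; have /pathP/(_ i jq) := qp => /(_ v)/and3P[_ _]; exact.
  apply: (qi i j); rewrite /= ?ltnS ?ij //.
  have nthE k : k <= size q -> nth s (s :: q) k = nth v (s :: q) k.
    by move=> kq; apply: set_nth_default.
  by rewrite !nthE ?(leq_trans (ltnW ij)) // hij !nthQ ?(leq_trans (ltnW ij)).
split; last first.
  by move=> x; rewrite inE => /predU1P[->|/qQ]; rewrite !inE ?eqxx // orbC => ->.
split=> //.
  rewrite cons_uniq qu andbT; apply: contra vQ; exact: qQ.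
move=> i j /andP[]; case: i j => [|i] [|j] //= ij jq; rewrite /cyc_adj /=.
  by rewrite vnth //; lia.
by rewrite inner; lia.
Qed.

(* Dirac's theorem. Choose [v] so that a component [B] of the non-neighbours of
   [v] is as large as possible. The vertices [S] of [W] adjacent to [B] form a
   clique unless there is a hole through [v]; by maximality each remaining vertex
   is adjacent to all of [S], so a simplicial vertex of the rest is simplicial
   in [W]. *)
Lemma simplicial_or_hole W : W != set0 ->
  (exists x0 c, hole x0 c /\ {subset c <= W}) \/ exists2 v, v \in W & clique (nbh v W).
Proof.
have [k] := ubnP #|W|; elim: k W => // k IHk W Wk W0.
have [[x0 [c hc]]|nohole] := pselect (exists x0 c, hole x0 c /\ {subset c <= W});
  first by left; exists x0, c.
right; have [/existsP[v0 /andP[v0W /set0Pn[c0 c0v]]]|full] :=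
    boolP [exists v, (v \in W) && (far v W != set0)]; last first.
  have /set0Pn[v vW] := W0; exists v => //; apply/cliqueP => x y; rewrite !inE.
  move=> /andP[xW _] /andP[yW _] xy; move: full; rewrite negb_exists => /forallP/(_ y).
  rewrite yW negbK => /eqP/setP/(_ x); rewrite !inE xW xy /=.
  by move/negbT; rewrite negbK.
pose ok (vc : T * T) := (vc.1 \in W) && (vc.2 \in far vc.1 W).
have ok0 : ok (v0, c0) by rewrite /ok v0W.
pose F vc := #|[set x | connect (within (far vc.1 W)) vc.2 x]|.
case: (@arg_maxnP _ (v0, c0) ok F ok0) => -[v c] /andP[/= vW cv] vcmax.
pose B := [set x | connect (within (far v W)) c x].
have cB : c \in B by rewrite inE connect0.
have Bfar x : x \in B -> x \in far v W.
  rewrite inE => /connectP[q qp ->];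
    case: q qp => [|y q] //= /andP[/and3P[_ yf _] /path_within qs].
  by have := mem_last y q; rewrite inE => /predU1P[->|/qs].
have BW x : x \in B -> x \in W by move/Bfar; rewrite inE => /andP[].
have Bv x : x \in B -> (x != v) && ~~ h x v by move/Bfar; rewrite inE => /andP[_].
pose S := [set s in W | (s \notin B) && [exists x in B, h x s]].
have Sv s : s \in S -> h s v.
  rewrite inE => /and3P[sW sB /exists_inP[x xB xs]]; apply: contraNT sB => nsv.
  have sv : s != v by apply: contraTneq xs => ->; have /andP[] := Bv x xB.
  have sf : s \in far v W by rewrite inE sW sv.
  have cx : connect (within (far v W)) c x by move: xB; rewrite inE.
  by rewrite inE; apply: connect_trans cx (connect1 _); rewrite /= sf xs Bfar.
pose R := [set r in W | (r \notin B) && ~~ [exists x in B, h x r]].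
have RB r x : r \in R -> x \in B -> ~~ h x r.
  rewrite inE => /and3P[_ _ /exists_inPn hr] xB; exact: hr.
have vR : v \in R.
  have vB : v \notin B by apply/negP => vB; have := Bv v vB; rewrite eqxx.
  rewrite inE vW vB.
  by apply/exists_inPn => x xB; have /andP[] := Bv x xB.
have RS r s : r \in R -> s \in S -> h r s.
  move=> rR; rewrite inE => /and3P[sW sB /exists_inP[x xB xs]]; apply: contraNT sB => nrs.
  have rB : r \notin B by move: rR; rewrite inE => /and3P[].
  have rW : r \in W by move: rR; rewrite inE => /and3P[].
  have sr : s != r by apply: contraTneq xs => ->; exact: RB.
  (* If [r] and [s] are non-adjacent, one component of the non-neighbours of [r] contains both [B]
     and [s], against the maximality of [B]. *)
  have Bfr y : y \in B -> y \in far r W.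
    move=> yB; rewrite inE BW // RB // andbT; by apply: contraNneq rB => <-.
  have sfr : s \in far r W by rewrite inE sW sr h_sym.
  have Bsub y : y \in B -> connect (within (far r W)) c y.
    rewrite inE; apply: connect_sub_comp => u w cu cw /and3P[_ _ huw].
    have [uB wB] : u \in B /\ w \in B by rewrite !inE.
    by rewrite /= huw !Bfr.
  apply: contraT => sB; have := vcmax (r, c); rewrite /ok /= rW Bfr // => /(_ isT).
  rewrite leqNgt => /negP[]; apply/proper_card/properP; split.
    by apply/subsetP => y yB; rewrite inE Bsub.
  exists s; last by [].
  by rewrite inE; apply: connect_trans (Bsub x xB) (connect1 _); rewrite /= Bfr // sfr.
have Sclique : {in S &, forall s s', s != s' -> h s s'}.
  move=> s s' sS s'S ss'; apply: contraT => nss'; case: nohole.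
  (* Both [s] and [s'] have neighbours in the connected set [B], where [v] has none. *)
  pose Q := s |: (s' |: B).
  have vB : v \notin B by move: vR; rewrite inE => /and3P[].
  have sv : s != v by apply: contraTneq (Sv s sS) => ->; rewrite h_irr.
  have s'v : s' != v by apply: contraTneq (Sv s' s'S) => ->; rewrite h_irr.
  have [||||||||q [hq qQ]] := @hole_of_path v s s' Q.
  - by rewrite !inE !negb_or ![v == _]eq_sym sv s'v; move: vB; rewrite inE.
  - by rewrite !inE eqxx.
  - by rewrite h_sym Sv.
  - by rewrite h_sym Sv.
  - by [].
  - by [].
  - move=> x xQ xs xs'; have xB : x \in B.
      by move: xQ; rewrite !in_setU1 (negPf xs) (negPf xs').
    by rewrite h_sym; have /andP[] := Bv x xB.
  - have BQ : {subset B <= Q} by move=> x xB; rewrite !in_setU1 xB !orbT.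
    have sQ : s \in Q by rewrite in_setU1 eqxx.
    have s'Q : s' \in Q by rewrite !in_setU1 eqxx orbT.
    move: sS s'S; rewrite !inE => /and3P[_ _ /exists_inP[x xB xs]] /and3P[_ _
      /exists_inP[y yB ys']].
    have xy : connect (within Q) x y.
      have cBc z : z \in B -> connect (within Q) c z.
        rewrite inE; apply: connect_sub_comp => u w cu cw /and3P[_ _ huw].
        have [uB wB] : u \in B /\ w \in B by rewrite !inE.
        by rewrite /= huw !BQ.
      apply: connect_trans (cBc y yB); rewrite (sym_connect_sym _) ?cBc //.
      by move=> a b /=; rewrite h_sym; case: (a \in Q); rewrite ?andbF.
    apply: connect_trans (connect1 _) (connect_trans xy (connect1 _)).
      by rewrite /= sQ BQ //= h_sym.
    by rewrite /= s'Q BQ.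
  exists v, (v :: q); split=> // x /qQ;
    rewrite !in_setU1 => /or4P[/eqP->|/eqP->|/eqP->|/BW] //.
    by move: sS; rewrite inE => /andP[].
  by move: s'S; rewrite inE => /andP[].
have RW : R \subset W by apply/subsetP => x; rewrite inE => /andP[].
have Rk : #|R| < k.
  rewrite -ltnS; apply: leq_trans Wk; rewrite ltnS; apply: proper_card.
  by apply/properP; split=> //; exists c; [exact: BW | rewrite inE cB andbF].
have R0 : R != set0 by apply/set0Pn; exists v.
case: (IHk R Rk R0) => [[x0 [p [hp pR]]]|[r rR /cliqueP rc]].
  by case: nohole; exists x0, p; split=> // x /pR/(subsetP RW).
exists r; first exact: (subsetP RW).
(* No vertex of [R] has a neighbour in [B]. *)
have nbr x : x \in nbh r W -> x \in nbh r R \/ x \in S.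
  rewrite inE => /andP[xW xr]; have xB : x \notin B.
    by apply/negP => xB; have := RB r x rR xB; rewrite xr.
  have [xe|xe] := boolP [exists y in B, h y x]; first by right; rewrite inE xW xB.
  by left; rewrite !inE xW xr andbT; move: xB; rewrite inE => ->.
apply/cliqueP => x y /nbr[xR|xS] /nbr[yR|yS] xy.
- exact: rc.
- by apply: RS => //; move: xR; rewrite inE => /andP[].
- by rewrite h_sym; apply: RS => //; move: yR; rewrite inE => /andP[].
- exact: Sclique.
Qed.

End Graph.

Import Order.TTheory GRing.Theory Num.Theory.
Local Open Scope ring_scope.

(** * Neighbourhoods in graphs without short holes *)

(** The matrix [P - 1] kills the constant column, so it is singular and has a left null vector [v].
    The triangle inequality gives [|v| <= |v| P] entrywise; both sides have the same sum, so
    equality holds and [|v|] can be normalized. *)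
Lemma stationary_distribution (R : realFieldType) n (P : 'I_n -> 'I_n -> R) :
  (0 < n)%N -> (forall i j, 0 <= P i j) -> (forall i, \sum_j P i j = 1) ->
  exists p : 'I_n -> R, [/\ forall i, 0 <= p i, \sum_i p i = 1 &
    forall j, \sum_i p i * P i j = p j].
Proof.
move=> n0 P0 P1; pose M : 'M[R]_n := \matrix_(i, j) P i j - 1%:M.
have /eqP : \det M = 0.
  apply/eqP; rewrite -det_tr; apply/det0P; exists (const_mx 1).
    apply/eqP => /rowP/(_ (Ordinal n0))/eqP; rewrite !mxE oner_eq0; exact/negP.
  apply/rowP => i; rewrite !mxE.
  under eq_bigr do rewrite !mxE mul1r.
  rewrite sumrB P1 (bigD1 i) //= eqxx big1 ?addr0 ?subrr // => j /negPf ji.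
  by rewrite eq_sym ji.
move=> /det0P[v v0 vM].
have vP j : \sum_i v ord0 i * P i j = v ord0 j.
  have /rowP/(_ j) := vM; rewrite mulmxBr mulmx1 !mxE => /eqP;
    rewrite subr_eq0 => /eqP <-.
  by apply: eq_bigr => i _; rewrite !mxE.
pose q i := `|v ord0 i|.
have qP j : q j <= \sum_i q i * P i j.
  rewrite /q -vP; apply: le_trans (ler_norm_sum _ _ _) _.
  by apply: ler_sum => i _; rewrite normrM (ger0_norm (P0 _ _)).
have qE j : \sum_i q i * P i j = q j.
  apply/eqP; rewrite -subr_eq0; apply/eqP.
  apply: (@psumr_eq0P _ _ predT (fun j => \sum_i q i * P i j - q j)) => //.
    by move=> i _; rewrite subr_ge0.
  rewrite sumrB exchange_big /= -[X in X - _](@eq_bigr _ _ _ _ _ _ q) ?subrr // => i _.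
  by rewrite -big_distrr /= P1 mulr1.
have q0 i : 0 <= q i by exact: normr_ge0.
have sq : 0 < \sum_i q i.
  rewrite lt_def sumr_ge0 // andbT; apply: contra v0 => /eqP s0.
  apply/eqP/rowP => i; rewrite mxE; apply/eqP; rewrite -normr_eq0; apply/eqP.
  exact: (@psumr_eq0P _ _ predT q).
exists (fun i => q i / \sum_i q i); split=> [i||j].
- by rewrite divr_ge0 // ltW.
- by rewrite -mulr_suml divff // gt_eqF.
- rewrite -[in RHS]qE mulr_suml; apply: eq_bigr => i _; ring.
Qed.

Section SizeBound.
Variables (R : realFieldType) (n k : nat) (h : rel 'I_n).
(** [A W i] stands for cohomology of the clique complex of [h[W]] in reduced degree [i - 1]. The
    counting argument sees it only through the last three hypotheses. *)
Variable A : {set 'I_n} -> nat -> Prop.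
Hypotheses (h_sym : symmetric h) (h_irr : irreflexive h) (k_ge1 : (1 <= k)%N).
Hypothesis hole_size : forall x0 c, hole h x0 c -> (k + 4 <= size c)%N.
Hypothesis A_neq0 : forall W i, A W i.+1 -> W != set0.
Hypothesis A_hole : forall W i, A W i.+2 -> exists x0 c, hole h x0 c /\ {subset c <= W}.
Hypothesis A_link : forall (W : {set 'I_n}) v i, v \in W -> A W i.+1 ->
  A (W :\ v) i.+1 \/ A (nbh h v W) i.
Implicit Types (W Q : {set 'I_n}) (mu : 'I_n -> R).

Local Notation b := ((k%:R + 4) / 2 : R).

Let b_gt1 : 1 < b.
Proof. have : (1 : R) <= k%:R by rewrite ler1n. lra. Qed.

(** Otherwise [x, u, y, w] is a hole of length 4, while holes have length at least [k + 4 >= 5]. *)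
Lemma common_nbh x y u w : x != y -> ~~ h x y -> u != w ->
  h x u -> h y u -> h x w -> h y w -> h u w.
Proof.
move=> xy nxy uw xu yu xw yw; apply: contraT => nuw.
have ne z t : h z t -> z != t by apply: contraTneq => ->; rewrite h_irr.
have : hole h x [:: x; u; y; w].
  split=> //=.
    by rewrite !inE !negb_or xy uw (ne _ _ xu) (ne _ _ xw) (ne _ _ yw) eq_sym (ne _ _ yu).
  move=> i j /andP[ij j4]; case: i j ij j4 => [|[|[|[|i]]]] [|[|[|[|j]]]] //= _ _;
    rewrite /cyc_adj /= ?xu ?xw ?yw ?(negPf nxy) ?(negPf nuw) // h_sym //.
by move=> /hole_size /=; rewrite leqNgt; lia.
Qed.

(* Holes have length at least [2 b] and meet cliques in at most two vertices, so
   uniform distributions on holes and their mixtures are spread. *)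
Definition spread W mu := [/\ forall x, 0 <= mu x, forall x, x \notin W -> mu x = 0,
  \sum_x mu x = 1 & forall Q, clique h Q -> \sum_(x in Q) mu x <= b^-1].

Definition mean_far W mu := \sum_x mu x * #|far h x W|%:R.

Lemma card_far W w : w \in W -> (#|far h w W| + #|nbh h w W|).+1 = #|W|.
Proof.
move=> wW; rewrite (cardsD1 w W) wW -(cardsID (far h w W) (W :\ w)) add1n;
  congr (_ + _).+1.
  by apply: eq_card => x; rewrite !inE; case: (x == w); case: (x \in W); case: (h x w).
apply: eq_card => x; rewrite !inE; have [->|_] := eqVneq x w;
  first by rewrite h_irr !andbF.
by case: (x \in W); case: (h x w).
Qed.

Lemma far_mono w W W' : W' \subset W -> (#|far h w W'| <= #|far h w W|)%N.
Proof.
by move=> /subsetP s; apply/subset_leq_card/subsetP => x; rewrite !inE => /andP[/s -> ->].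
Qed.

(** On a hole with [m >= k + 4] vertices a clique has uniform mass at most [2 / m <= b^-1], and each
    vertex has at least [m - 3 >= k + 1] non-neighbours. *)
Lemma hole_spread W i : A W i.+2 -> exists mu, spread W mu /\ k.+1%:R <= mean_far W mu.
Proof.
move=> /A_hole[x0 [c [hc cW]]]; have [cu c4 _] := hc; have ck := hole_size hc.
pose m : R := (size c)%:R; have m0 : 0 < m by rewrite ltr0n; lia.
have mk : k%:R + 4 <= m by rewrite -natrD ler_nat.
pose mu x : R := if x \in c then m^-1 else 0.
have sum_mu Q : \sum_(x in Q) mu x = #|Q :&: [set x in c]|%:R / m.
  rewrite /mu -big_mkcondr /= mulr_natl -sumr_const.
  by apply: eq_bigl => x; rewrite !inE.
have cE : #|[set x in c]| = size c by rewrite cardsE (card_uniqP cu).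
exists mu; split.
  split=> [x|x xW||Q /cliqueP hQ].
  - by rewrite /mu; case: ifP => // _; rewrite invr_ge0 ltW.
  - by rewrite /mu; case: ifP => // /cW; rewrite (negPf xW).
  - have -> : \sum_x mu x = \sum_(x in [set: 'I_n]) mu x by apply: eq_bigl => x;
    rewrite inE.
    by rewrite sum_mu setTI cE divff ?gt_eqF.
  - rewrite sum_mu ler_pdivrMr // invf_div.
    have b2 : #|Q :&: [set x in c]|%:R <= 2 :> R by rewrite ler_nat (hole_clique h_sym
      hc).
    apply: le_trans b2 _; rewrite mulrAC ler_pdivlMr ?ler_pM2l ?ltr0n //.
    by rewrite ltr_wpDl.
have E x : mu x * (k.+1)%:R <= mu x * #|far h x W|%:R.
  rewrite /mu; case: ifP => xc; last by rewrite !mul0r.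
  rewrite ler_pM2l ?invr_gt0 // ler_nat.
  have cs : [set x in c] \subset W by apply/subsetP => y; rewrite inE; exact: cW.
  apply: leq_trans (far_mono x cs).
  have xC : x \in [set x in c] by rewrite inE.
  have := card_far xC; have := hole_degree h_sym h_irr hc xc; rewrite cE.
  have -> : #|[set y in c | h y x]| = #|nbh h x [set x in c]|.
    by apply: eq_card => y; rewrite !inE.
  lia.
apply: le_trans (ler_sum _ (fun x _ => E x)).
have -> : \sum_x mu x * k.+1%:R = (\sum_(x in [set: 'I_n]) mu x) * k.+1%:R.
  by rewrite mulr_suml; apply: eq_bigl => x; rewrite inE.
by rewrite sum_mu setTI cE divff ?gt_eqF // mul1r.
Qed.

(** The non-neighbours of a vertex of [N(w)] are counted separately inside [N(w)] and inside
    [far h w W]. After exchanging sums, a vertex [y] of the latter counts with the mass of its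
    non-neighbours in [N(w)]; by [common_nbh] its neighbours there form a clique, of mass at most
    [b^-1]. *)
Lemma mean_far_link W w mu : w \in W -> spread (nbh h w W) mu ->
  mean_far (nbh h w W) mu + (1 - b^-1) * #|far h w W|%:R <= mean_far W mu.
Proof.
move=> wW [mu0 muN mu1 muQ].
have split_far u : u \in nbh h w W ->
    #|far h u (nbh h w W)|%:R + \sum_(y in far h w W) (y \in far h u W)%:R <= #|far h u
      W|%:R :> R.
  move=> uN; rewrite -natr_sum -natrD ler_nat -[X in (X + _ <= _)%N]sum1_card.
  rewrite -[X in (_ <= X)%N]sum1_card [X in (_ <= X)%N](bigID (mem (nbh h w W))) /=;
    apply: leq_add.
    by rewrite leq_eqVlt; apply/orP; left; apply/eqP/eq_bigl => y; rewrite !inE;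
      case: (y \in W); case: (h y w); rewrite ?andbF ?andbT.
  rewrite [X in (_ <= X)%N]big_mkcond [X in (X <= _)%N]big_mkcond; apply: leq_sum => y _.
  by rewrite !inE; case: (y \in W); case: (h y w); case: (y == w); case: (y == u);
    case: (h y u).
have far_mass y : y \in far h w W -> 1 - b^-1 <= \sum_x mu x * (y \in far h x W)%:R.
  move=> yw; pose Q := [set u in nbh h w W | h y u].
  have Qc : clique h Q.
    move: yw; rewrite inE => /and3P[yW yNw nyw].
    apply/cliqueP => u v; rewrite !inE => /andP[/andP[_ uw] yu] /andP[/andP[_ vw] yv] uv.
    by apply: (@common_nbh w y) => //; rewrite 1?eq_sym 1?h_sym.
  rewrite lerBlDr -[X in X <= _]mu1.
  have := muQ Q Qc; rewrite -(lerD2l (\sum_x mu x * (y \in far h x W)%:R));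
    apply: le_trans.
  rewrite [X in _ + X]big_mkcond -big_split; apply: ler_sum => x _ /=.
  have [xN|/muN ->] := boolP (x \in nbh h w W); last by rewrite mul0r if_same addr0.
  have [xQ|nxQ] := boolP (x \in Q); first by rewrite lerDr mulr_ge0 // ler0n.
  move: yw; rewrite inE => /and3P[yW yNw nyw].
  suff -> : y \in far h x W by rewrite mulr1 addr0.
  rewrite inE yW; move: nxQ; rewrite inE xN /= => ->; rewrite andbT.
  by apply: contraTneq xN => <-; rewrite inE (negPf nyw) andbF.
rewrite /mean_far [(1 - _) * _]mulrC -[_%:R]mulr1 -mulrA mul1r.
have -> : #|far h w W|%:R * (1 - b^-1) = \sum_(y in far h w W) (1 - b^-1).
  by rewrite sumr_const mulr_natl.
apply: le_trans (lerD (lexx _) (ler_sum _ far_mass)) _.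
rewrite exchange_big -big_split; apply: ler_sum => x _ /=.
rewrite -big_distrr -mulrDr /=.
have [xN|/muN ->] := boolP (x \in nbh h w W); last by rewrite !mul0r.
by apply: ler_wpM2l => //; exact: split_far.
Qed.

(** Delete vertices as long as the cohomology survives; once no deletion is possible, [A_link]
    leaves only the neighbourhood alternative at every vertex. *)
Lemma A_descend W i : A W i.+1 ->
  exists2 W' : {set 'I_n}, W' \subset W & A W' i.+1 /\ forall v, v \in W' ->
    A (nbh h v W') i.
Proof.
have [d] := ubnP #|W|; elim: d W => // d IHd W Wd AW.
have [[v [vW Av]]|nv] := pselect (exists v, v \in W /\ A (W :\ v) i.+1).
  have [|W' W'W HW'] := IHd (W :\ v) _ Av; first by move: Wd; rewrite (cardsD1 v) vW; lia.
  by exists W' => //; apply: subset_trans W'W _; exact: subD1set.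
exists W => //; split=> // v vW; have [Av|//] := A_link vW AW.
by case: nv; exists v.
Qed.

Lemma spreadS (W' : {set 'I_n}) W mu : W' \subset W -> spread W' mu -> spread W mu.
Proof.
move=> s [m0 mN m1 mQ]; split=> // x xW; apply: mN; exact: contra (subsetP s x) xW.
Qed.

Lemma mean_farS (W' : {set 'I_n}) W mu : W' \subset W -> spread W' mu ->
  mean_far W' mu <= mean_far W mu.
Proof.
move=> s [m0 _ _ _]; apply: ler_sum => x _; rewrite ler_wpM2l // ler_nat; exact: far_mono.
Qed.

Lemma spread_mean_far W i : A W i.+2 ->
  exists mu, spread W mu /\ k.+1%:R * b ^+ i <= mean_far W mu.
Proof.
elim: i W => [|i IHi] W AW; first by rewrite mulr1; exact: hole_spread AW.
have [W' W'W [AW' lk]] := A_descend AW.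
suff [mu [smu mle]] : exists mu, spread W' mu /\ k.+1%:R * b ^+ i.+1 <= mean_far W' mu.
  exists mu; split; first exact: spreadS smu.
  by apply: le_trans mle _; exact: mean_farS.
have /set0Pn[w0 w0W] := A_neq0 AW'.
have /choice[m mP] : forall w, exists mu, w \in W' ->
    spread (nbh h w W') mu /\ k.+1%:R * b ^+ i <= mean_far (nbh h w W') mu.
  move=> w; have [wW|_] := boolP (w \in W'); last by exists (fun _ => 0).
  by have [mu hmu] := IHi _ (lk w wW); exists mu.
(* Rows outside [W'] are redirected to [w0], so that [p] is a transition kernel on all of ['I_n];
   every row is supported in [W'], hence so is the stationary distribution. *)
pose p w := m (if w \in W' then w else w0).
have pP w : spread W' (p w).
  have [w' w'W' hw] : exists2 w', w' \in W' & p w = m w'.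
    by rewrite /p; case: ifP => wW; [exists w | exists w0].
  rewrite hw; apply: spreadS (mP _ _).1 => //.
  by apply/subsetP => x; rewrite inE => /andP[].
have [|||pi [pi0 pi1 piP]] := @stationary_distribution R n p.
- exact: leq_ltn_trans (leq0n _) (ltn_ord w0).
- by move=> x y; have [? _ _ _] := pP x.
- by move=> x; have [_ _ ? _] := pP x.
have piN x : x \notin W' -> pi x = 0.
  move=> xW; rewrite -piP big1 // => y _; have [_ pN _ _] := pP y; by rewrite pN ?mulr0.
exists pi; split.
  split=> // Q Qc.
  have -> : \sum_(x in Q) pi x = \sum_y pi y * \sum_(x in Q) p y x.
    under [RHS]eq_bigr do rewrite mulr_sumr.
    by rewrite exchange_big; apply: eq_bigr => x _; rewrite piP.
  apply: le_trans (_ : \sum_y pi y * b^-1 <= _); last by rewrite -mulr_suml pi1 mul1r.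
  by apply: ler_sum => y _; apply: ler_wpM2l => //; have [_ _ _] := pP y; apply.
(* By stationarity the mean under [pi] is the [pi]-average of the means under the rows of [p]. *)
have E : mean_far W' pi = \sum_w pi w * mean_far W' (p w).
  rewrite /mean_far; under [RHS]eq_bigr do rewrite mulr_sumr.
  rewrite exchange_big; apply: eq_bigr => x _; rewrite -piP mulr_suml.
  by apply: eq_bigr => y _; rewrite mulrA.
have b0 : 0 < b by apply: lt_trans ltr01 b_gt1.
(* With [M] the mean under [pi] this reads [(k + 1) b^i + (1 - 1/b) M <= M], that is,
   [M >= (k + 1) b^(i + 1)]. *)
have key : k.+1%:R * b ^+ i + (1 - b^-1) * mean_far W' pi <= mean_far W' pi.
  rewrite [X in _ <= X]E {1}/mean_far mulr_sumr.
  have -> : k.+1%:R * b ^+ i = \sum_w pi w * (k.+1%:R * b ^+ i).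
    by rewrite -mulr_suml pi1 mul1r.
  rewrite -big_split; apply: ler_sum => w _ /=.
  rewrite [X in _ + X]mulrCA -mulrDr; have [wW|/piN ->] := boolP (w \in W');
    last by rewrite !mul0r.
  apply: ler_wpM2l => //; have [sm mm] := mP w wW.
  by rewrite /p wW; apply: (le_trans _ (mean_far_link wW sm)); rewrite lerD2r.
move: key; rewrite mulrBl mul1r addrCA gerDl subr_le0 => key.
by rewrite exprSr mulrA -ler_pdivlMr // [X in _ <= X]mulrC.
Qed.

Lemma size_bound W s : A W s.+1 -> 1 + \sum_(j < s) k.+1%:R * b ^+ j <= #|W|%:R.
Proof.
elim: s W => [|s IHs] W AW.
  by rewrite big_ord0 addr0 ler1n card_gt0 (A_neq0 AW).
have [W' W'W [AW' lk]] := A_descend AW.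
apply: le_trans (_ : #|W'|%:R <= _); last by rewrite ler_nat subset_leq_card.
have [mu [[mu0 muN mu1 _] mle]] := spread_mean_far AW'.
have [w wW wf] : exists2 w, w \in W' & k.+1%:R * b ^+ s <= #|far h w W'|%:R.
  apply: contrapT => no; move: mle; apply/negP; rewrite -ltNge.
  have -> : k.+1%:R * b ^+ s = \sum_x mu x * (k.+1%:R * b ^+ s).
    by rewrite -mulr_suml mu1 mul1r.
  rewrite /mean_far.
  have lt x : x \in W' -> #|far h x W'|%:R < k.+1%:R * b ^+ s.
    by move=> xW; rewrite ltNge; apply/negP => h'; apply: no; exists x.
  have [w mw] : exists w, mu w != 0.
    apply: contrapT => no'; have /eqP : \sum_x mu x = 0.
      by apply: big1 => x _; apply/eqP; apply: contrapT => /negP nz; apply: no'; exists x.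
    by rewrite mu1 oner_eq0.
  have wW : w \in W' by apply: contraTT mw => /muN ->; rewrite eqxx.
  (* If every vertex of [W'] fell below the bound, so would the mean: no [G x] is negative, and
     [G w] is nonzero. *)
  pose G x := mu x * (k.+1%:R * b ^+ s - #|far h x W'|%:R).
  have G0 x : 0 <= G x.
    have [/lt/ltW xW|/muN m0] := boolP (x \in W'); last by rewrite /G m0 mul0r.
    by rewrite mulr_ge0 // subr_ge0.
  rewrite -subr_gt0 -sumrB lt_neqAle eq_sym; apply/andP; split; last first.
    by apply: sumr_ge0 => x _; rewrite -mulrBr; exact: G0.
  apply/negP => /eqP s0; have /(_ w isT)/eqP : forall x, predT x -> G x = 0.
    apply: psumr_eq0P => //; rewrite -[RHS]s0; apply: eq_bigr => x _; exact: mulrBr.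
  by rewrite mulf_eq0 (negPf mw) subr_eq0 gt_eqF ?lt.
rewrite -(card_far wW) big_ord_recr /= -[(_ + _).+1]addn1 !natrD.
by have := IHs _ (lk w wW); lra.
Qed.

End SizeBound.

(** * Logarithms *)

Section Logarithm.
Variable R : realType.

Lemma ln_ge_sub1V (x : R) : 0 < x -> 1 - x^-1 <= ln x.
Proof.
move=> x0; have V0 : 0 < x^-1 by rewrite invr_gt0.
have [|] := boolP (-1 < x^-1 - 1) => [/le_ln1Dx|]; last by lra.
have -> : 1 + (x^-1 - 1) = x^-1 by ring.
by rewrite lnV ?posrE //; lra.
Qed.

(** Here [ln (6/5) >= 1 - 5/6 = 1/6], and [(6/5)^6 < 3]. *)
Lemma ln3_ge1 : 1 <= ln (3 : R).
Proof.
have x0 : 0 < (6 / 5 : R) by lra.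
have l1 : 1 - (6 / 5)^-1 <= ln (6 / 5 : R) by exact: ln_ge_sub1V.
have : ln ((6 / 5 : R) ^+ 6) <= ln 3.
  rewrite ler_ln ?posrE ?exprn_gt0 //; lra.
rewrite lnXn // -[ln _ *+ _]mulr_natl; move: l1.
have -> : (6 / 5 : R)^-1 = 5 / 6 by field.
lra.
Qed.

(** Write [S] for the sum of the [b^j], [j < s], so that [b^s = 1 + (b - 1) S] and
    [(k + 1) S <= n - 1]. The argument of the logarithm is then at least [S ln b + 1/b >= S (1 -
    1/b) + 1/b = b^(s - 1)]. *)
Lemma logb_bound (k n s : nat) : (1 <= k)%N ->
  1 + \sum_(j < s) (k.+1)%:R * ((k%:R + 4) / 2) ^+ j <= n%:R :> R ->
  (s%:R + 2 : R) <= logb ((k%:R + 4) / 2)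
     ((n%:R - 1) * ln ((k%:R + 4) / 2) / (k%:R + 1) + 2 / (k%:R + 4)) + 3.
Proof.
rewrite -(ler1n R) => k1; rewrite -mulr_sumr -natr1; set b : R := (k%:R + 4) / 2 => hn.
have b1 : 1 < b by rewrite /b; lra.
have b0 : 0 < b by lra.
have lnb : 0 < ln b by exact: ln_gt0.
have lb : 1 - b^-1 <= ln b by exact: ln_ge_sub1V.
have -> : 2 / (k%:R + 4) = b^-1 by rewrite /b invf_div.
set X := _ + b^-1; set S := \sum_(j < s) b ^+ j in hn.
have S0 : 0 <= S by apply: sumr_ge0 => j _; rewrite exprn_ge0 ?ltW.
have SE : b ^+ s = 1 + (b - 1) * S by rewrite /S -subrX1; ring.
have XS : S * ln b + b^-1 <= X.
  rewrite /X lerD2r mulrAC; apply: ler_wpM2r; first exact: ltW.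
  by rewrite ler_pdivlMr; lra.
have Xb : b ^+ s / b <= X.
  apply: le_trans XS; rewrite SE mulrDl mul1r addrC lerD2r mulrAC mulrC.
  apply: ler_wpM2l => //; rewrite mulrBl mul1r divff ?gt_eqF //.
have bs0 : 0 < b ^+ s / b by rewrite divr_gt0 // exprn_gt0.
have lX : ln (b ^+ s / b) <= ln X by rewrite ler_ln ?posrE //; exact: lt_le_trans Xb.
rewrite /logb -lerBlDr ler_pdivlMr //; apply: le_trans lX.
rewrite ln_div ?posrE ?exprn_gt0 // lnXn // -[ln _ *+ _]mulr_natl; lra.
Qed.

(* Here the argument of the logarithm is nonpositive, and [ln] is 0 there. *)
Lemma logb_bound_no_vertex (k : nat) : (1 <= k)%N ->
  (2 : R) <= logb ((k%:R + 4) / 2)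
     ((0%:R - 1) * ln ((k%:R + 4) / 2) / (k%:R + 1) + 2 / (k%:R + 4)) + 3.
Proof.
rewrite -(ler1n R) => k1; set b : R := (k%:R + 4) / 2.
have b1 : 1 < b by rewrite /b; lra.
have b0 : 0 < b by lra.
rewrite [X in logb _ X](_ : _ = (b^-1 * (k%:R + 1) - ln b) / (k%:R + 1)); last first.
  by rewrite /b invf_div; field; apply/andP; split; lra.
rewrite /logb ln0 ?mul0r; first lra.
rewrite pmulr_lle0 ?invr_gt0; last lra.
(* Since [k + 1 = 2 b - 3], the claim is [2 - 3/b <= ln b]; it follows from [ln 3 >= 1] and
   [ln (b/3) >= 1 - 3/b]. *)
rewrite subr_le0; have -> : ln b = ln 3 + ln (b / 3).
  by rewrite ln_div ?posrE //; lra.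
have h : 1 - (b / 3)^-1 <= ln (b / 3) by apply: ln_ge_sub1V; rewrite divr_gt0.
have := ln3_ge1; move: h; rewrite invf_div.
have -> : b^-1 * (k%:R + 1) = 2 - 3 / b by rewrite /b; field; lra.
lra.
Qed.

End Logarithm.

(** * The simplex *)

Section Signs.
Variables (R : comNzRingType) (N : nat).
Implicit Types (u v : 'I_N) (W t : {set 'I_N}) (f : {set 'I_N} -> R).

(** The sign of moving [v] to its place in the exterior product of the elements of [t] in increasing
    order. *)
Definition sgn v t : R := (-1) ^+ #|[set u in t | (u < v)%N]|.

Lemma sgnK v t : sgn v t * sgn v t = 1.
Proof. by rewrite -expr2 sqrr_sign. Qed.

Lemma sgn_neq0 v t : sgn v t != 0.
Proof. by rewrite signr_eq0. Qed.

Lemma sgn0 v : sgn v set0 = 1.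
Proof. by rewrite /sgn (_ : [set u in set0 | _] = set0) ?cards0 //; apply/setP => u;
  rewrite !inE. Qed.

Lemma sgn_setU1 u v t :
  u \notin t -> sgn v (u |: t) = (-1) ^+ (u < v)%N * sgn v t.
Proof.
move=> ut; rewrite /sgn -exprD; congr (_ ^+ _).
case: ltnP => uv.
  have -> : [set w in u |: t | (w < v)%N] = u |: [set w in t | (w < v)%N].
    by apply/setP => w; rewrite !inE; case: eqVneq => [->|].
  by rewrite cardsU1 !inE (negPf ut).
rewrite add0n; congr #|pred_of_set _|; apply/setP => w; rewrite !inE.
by case: eqVneq => [->|//]; rewrite ltnNge uv andbF (negPf ut).
Qed.

(** Exactly one of [u < v] and [v < u] holds, so exactly one of the two signs changes. *)
Lemma sgn_swap u v t : u != v -> u \notin t -> v \notin t ->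
  sgn u (v |: t) * sgn v (u |: t) = - (sgn u t * sgn v t).
Proof.
move=> uv ut vt; rewrite !sgn_setU1 //.
have : (u < v)%N = ~~ (v < u)%N.
  by rewrite -leqNgt [RHS]leq_eqVlt [u == v :> nat](negPf uv).
by move=> ->; case: (v < u)%N => /=; rewrite ?expr0 ?expr1 ?mul1r ?mulN1r ?mulrN ?mulNr.
Qed.

(* The Koszul differential on the subsets of [W]: [f t] is the coefficient of the
   basis element indexed by [t]. *)
Definition bd (W : {set 'I_N}) (f : {set 'I_N} -> R) t : R :=
  \sum_(v in W :\: t) sgn v t * f (v |: t).

(** Exterior multiplication by the basis element of [v], the contracting homotopy of [bd]. *)
Definition htp v (f : {set 'I_N} -> R) t : R :=
  if v \in t then sgn v (t :\ v) * f (t :\ v) else 0.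

(** Each pair [v < u] is matched with its reversal. Comparing the sum with its own opposite would
    give nothing in characteristic 2. *)
Lemma sgn_sum_anti (P : pred 'I_N) (F : 'I_N -> 'I_N -> R) :
  (forall u v, u != v -> P u -> P v -> F u v = - F v u) ->
  \sum_(u | P u) \sum_(v | P v && (v != u)) F u v = 0.
Proof.
move=> anti.
have split u : P u -> \sum_(v | P v && (v != u)) F u v =
    \sum_(v | P v && (v < u)%N) F u v + \sum_(v | P v && (u < v)%N) F u v.
  move=> _; rewrite (bigID (fun v : 'I_N => (v < u)%N)) /=.
  by congr (_ + _); apply: eq_bigl => v; rewrite -(inj_eq val_inj) /=;
    case: ltngtP => ?; rewrite ?andbF ?andbT.
rewrite (eq_bigr _ split) big_split /= addrC.
rewrite (exchange_big_dep P) /=; last by move=> u v _ /andP[].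
rewrite -big_split big1 //= => u Pu.
rewrite (eq_bigl (fun v => P v && (v < u)%N)); last by move=> v; rewrite Pu.
rewrite -big_split big1 //= => v /andP[Pv vu].
by rewrite anti ?addNr // -(inj_eq val_inj) /= neq_ltn vu.
Qed.

Lemma bd_bd W f t : bd W (bd W f) t = 0.
Proof.
rewrite /bd.
transitivity (\sum_(u in W :\: t) \sum_(v | (v \in W :\: t) && (v != u))
    sgn u t * (sgn v (u |: t) * f (v |: (u |: t)))).
  apply: eq_bigr => u _; rewrite big_distrr /=; apply: eq_bigl => v.
  by rewrite !inE negb_or; case: (v \in W); case: (v == u); case: (v \in t).
apply: sgn_sum_anti => u v uv; rewrite !inE => /andP[ut _] /andP[vt _].
have -> : v |: (u |: t) = u |: (v |: t) by rewrite !setUA [[set v] :|: _]setUC.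
have := congr1 (fun x => sgn v t * sgn v (u |: t) * x) (sgn_swap uv ut vt).
set a := sgn u t; set b := sgn v t; set c := sgn v _; set d := sgn u _.
have cc : c * c = 1 by exact: sgnK.
have bb : b * b = 1 by exact: sgnK.
set x := f _ => e.
have e1 : b * d = - (a * c).
  transitivity (b * d * (c * c)); first by rewrite cc mulr1.
  transitivity (- (a * c * (b * b))); last by rewrite bb mulr1.
  by transitivity (b * c * (d * c)); [ring | rewrite e; ring].
by rewrite !mulrA e1; ring.
Qed.

(** The index [v] contributes [f t], in the first composite if [v] is outside [t] and in the second
    otherwise; the other indices cancel by [sgn_swap]. *)
Lemma bd_htp W v f t : v \in W -> bd W (htp v f) t + htp v (bd W f) t = f t.
Proof.
move=> vW; have [vt|vt] := boolP (v \in t); last first.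
  rewrite /htp (negPf vt) addr0 /bd (bigD1 v) ?inE ?vt //=; rewrite ?eqxx /= setU1K //.
  rewrite mulrA sgnK mul1r big1 ?addr0 // => u /andP[_ uv].
  by rewrite !inE eq_sym (negPf uv) (negPf vt) mulr0.
rewrite -(setD1K vt); set r := t :\ v.
have vr : v \notin r by rewrite !inE eqxx.
rewrite /htp setU11 setU1K // /bd [X in _ + _ * X](bigD1 v) ?inE ?eqxx //=.
rewrite mulrDr mulrA sgnK mul1r addrCA -[RHS]addr0; congr (_ + _).
rewrite big_distrr /=.
rewrite (eq_bigl (fun u => (u \in W :\: r) && (u != v))); last first.
  by move=> u; rewrite !inE; case: (u == v); case: (u \in W); rewrite ?andbT ?andbF.
rewrite -big_split big1 //= => u /andP[]; rewrite !inE => /andP[ur _] uv.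
have ur' : u \notin r by rewrite !inE.
rewrite eqxx orbT /=.
have -> : (u |: (v |: r)) :\ v = u |: r.
  apply/setP => w; rewrite !inE.
  by case: (eqVneq w v) => [->|]; rewrite //= ?(eq_sym v) ?(negPf uv).
rewrite !mulrA sgn_swap //; ring.
Qed.

End Signs.

(** * Taylor complexes by multidegree *)

Section Multidegree.
Variables (K : fieldType) (n N : nat) (g : 'I_N -> 'X_{1..n}).
Local Notation S := {mpoly K[n]}.
Implicit Types (m a b : 'X_{1..n}) (s t : {set 'I_N}).

Lemma mcoeffXM (p : S) b a :
  ('X_[b] * p)@_a = if (b <= a)%MM then p@_(a - b) else 0.
Proof.
case: ifP => [ba|nba]; first by rewrite -{1}(submK ba) addmC mulrC mcoeffMX.
rewrite mulrC; apply: memN_msupp_eq0; rewrite (perm_mem (msuppMX p b)).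
by apply/mapP => -[c _ ac]; rewrite ac lem_addr in nba.
Qed.

Definition lcmset s : 'X_{1..n} := [multinom \max_(v in s) g v i | i < n].

Lemma lcmset_le s m : (lcmset s <= m)%MM = (s \subset [set v | (g v <= m)%MM]).
Proof.
apply/mnm_lepP/subsetP => [le v vs|sub i].
  rewrite inE; apply/mnm_lepP => i; apply: leq_trans (le i).
  by rewrite mnmE; apply: leq_bigmax_cond.
rewrite mnmE; apply/bigmax_leqP => v vs.
by have := sub v vs; rewrite inE => /mnm_lepP.
Qed.

Lemma lcmset_mono s t : s \subset t -> (lcmset s <= lcmset t)%MM.
Proof.
move=> st; rewrite lcmset_le; apply: subset_trans st _.
by rewrite -lcmset_le lepm_refl.
Qed.

Lemma lcmset0 : lcmset set0 = 0%MM.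
Proof. by apply/mnmP => i; rewrite mnmE big_set0 mnm0E. Qed.

Section Chains.
Variable r : nat.
Implicit Types (u w : {set 'I_N} -> 'rV[S]_r).

(** The differential of the Taylor complex on the monomials [g], tensored with a free module of rank
    [r]. When [g] lists the variables this is the Koszul complex. *)
Definition taylor_bd u t : 'rV[S]_r :=
  \sum_(v in ~: t) (sgn K v t *: 'X_[lcmset (v |: t) - lcmset t]) *: u (v |: t).

(** The part of [u] in multidegree [m]: the basis element of [s] has multidegree [lcmset s]. The
    guard is there because subtraction of exponents is truncated. *)
Definition piece m u (c : 'I_r) s : K :=
  if (lcmset s <= m)%MM then (u s ord0 c)@_(m - lcmset s) else 0.

(** The monomial factors only shift coefficients, so in multidegree [m] the simplex on the
    generators dividing [m] remains. *)
Lemma piece_taylor_bd m u c t : t \subset [set v | (g v <= m)%MM] ->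
  piece m (taylor_bd u) c t = bd [set v | (g v <= m)%MM] (piece m u c) t.
Proof.
set W := [set v | _]; move=> tW;
  rewrite /piece lcmset_le tW /taylor_bd summxE raddf_sum /=.
rewrite /bd [LHS](bigID (mem W)) /= [X in _ + X]big1 ?addr0.
  apply: eq_big => [v|v /andP[_ vW]]; first by rewrite !inE.
  rewrite mxE -scalerAl mcoeffZ mcoeffXM lcmset_le subUset sub1set vW tW /=.
  have le1 : (lcmset t <= lcmset (v |: t))%MM by rewrite lcmset_mono ?subsetUr.
  have le2 : (lcmset (v |: t) <= m)%MM by rewrite lcmset_le subUset sub1set vW.
  have -> : (lcmset (v |: t) - lcmset t <= m - lcmset t)%MM.
    by apply/mnm_lepP => i; rewrite !mnmBE leq_sub2r //; exact/mnm_lepP.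
  congr (_ * mcoeff _ _); apply/mnmP => i; rewrite !mnmBE.
  by move/mnm_lepP: le1 => /(_ i) le1; move/mnm_lepP: le2 => /(_ i) le2;
    rewrite subnBA // subnK // (leq_trans le1).
move=> v /andP[_ vW]; rewrite mxE -scalerAl mcoeffZ mcoeffXM.
case: ifP => [/mnm_lepP le|_]; last by rewrite mulr0.
case/negP: vW; have : (lcmset (v |: t) <= m)%MM.
  apply/mnm_lepP => i; have := le i; rewrite !mnmBE leq_subLR subnKC //.
  by have : (lcmset t <= m)%MM; [rewrite lcmset_le | move/mnm_lepP].
by rewrite lcmset_le subUset sub1set => /andP[].
Qed.

Lemma piece_eq u w :
  (forall m c s, s \subset [set v | (g v <= m)%MM] -> piece m u c s = piece m w c s) ->
  u =1 w.
Proof.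
move=> e s; apply/rowP => c; apply/mpolyP => a.
have le : (lcmset s <= a + lcmset s)%MM by rewrite lem_addl.
have := e (a + lcmset s)%MM c s; rewrite -lcmset_le /piece le addmK; exact.
Qed.

Lemma piece_assemble d (f : 'X_{1..n} -> 'I_r -> {set 'I_N} -> K) :
  (forall m c s, f m c s != 0 -> (mdeg m < d)%N) ->
  exists u, (forall m c s, s \subset [set v | (g v <= m)%MM] -> piece m u c s = f m c s)
    /\ forall s c a, (u s ord0 c)@_a = f (a + lcmset s)%MM c s.
Proof.
move=> fd.
pose u s : 'rV[S]_r := \row_c \sum_(a : 'X_{1..n < d}) f (a + lcmset s)%MM c s *: 'X_[a].
have uE s c a : (u s ord0 c)@_a = f (a + lcmset s)%MM c s.
  rewrite mxE; have [ad|da] := ltnP (mdeg a) d.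
    by rewrite (mcoeff_mpoly (fun a => f (a + lcmset s)%MM c s)).
  rewrite raddf_sum /= big1 => [|b _].
    apply/esym/eqP/negPn; apply/negP => /fd; rewrite mdegD ltnNge => /negP; apply.
    by rewrite (leq_trans da) ?leq_addr.
  rewrite mcoeffZ mcoeffX; case: eqP => [ba|_]; last by rewrite mulr0.
  by move: da; rewrite -ba leqNgt bmdeg.
exists u; split=> // m c s; rewrite -lcmset_le /piece => le.
by rewrite le uE submK.
Qed.

Lemma taylor_bdB u w t : taylor_bd (fun s => u s - w s) t = taylor_bd u t - taylor_bd w t.
Proof. by rewrite /taylor_bd -sumrB; apply: eq_bigr => v _; rewrite scalerBr. Qed.

Lemma eq_taylor_bd u w : u =1 w -> taylor_bd u =1 taylor_bd w.
Proof. by move=> e t; apply: eq_bigr => v _; rewrite e. Qed.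

Lemma eq_bd (W : {set 'I_N}) (f h : {set 'I_N} -> K) t :
  (forall v, v \in W -> f (v |: t) = h (v |: t)) -> bd W f t = bd W h t.
Proof. by move=> e; apply: eq_bigr => v; rewrite inE => /andP[_ vW]; rewrite e. Qed.

Lemma taylor_bd_taylor_bd u t : taylor_bd (taylor_bd u) t = 0.
Proof.
move: t; apply: piece_eq => m c t tW; rewrite piece_taylor_bd //.
transitivity (bd [set v | (g v <= m)%MM] (bd [set v | (g v <= m)%MM] (piece m u c)) t).
  by apply: eq_bd => v vW; rewrite piece_taylor_bd // subUset sub1set vW.
by rewrite bd_bd /piece mxE mcoeff0 if_same.
Qed.

Lemma piece0 m c t u : u t = 0 -> piece m u c t = 0.
Proof. by move=> e; rewrite /piece e mxE mcoeff0 if_same. Qed.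

(* [P] controls the multidegrees of the preimage, so that homogeneity passes to
   it. In each multidegree [m] the complex is that of the full simplex on the
   generators dividing [m], contracted onto one of them. *)
Lemma taylor_bd_exact p (u : {set 'I_N} -> 'rV[S]_r) (P : 'X_{1..n} -> 'I_r -> Prop) :
  (forall s, #|s| != p -> u s = 0) ->
  (forall t, taylor_bd u t = 0) ->
  (forall m c s, piece m u c s != 0 -> P m c) ->
  (forall m c s, piece m u c s != 0 -> exists v, (g v <= m)%MM) ->
  exists w, [/\ (forall s, #|s| != p.+1 -> w s = 0), taylor_bd w =1 u &
    (forall m c s, piece m w c s != 0 -> P m c)].
Proof.
move=> up ubd uP uv.
pose f m c s : K := if [pick v | (g v <= m)%MM] is Some v then
   (if (lcmset s <= m)%MM then htp v (piece m u c) s else 0) else 0.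
(* A bound on the multidegrees in which [u] is nonzero, as [piece_assemble] requires: entry degree
   plus the degree of the largest lcm. *)
pose D := ((\max_(s : {set 'I_N}) \max_(c < r) msize (u s ord0 c)) +
  mdeg (lcmset setT)).+1.
have hD m c s : piece m u c s != 0 -> (mdeg m < D)%N.
  rewrite /piece; case: ifP => [le|_]; last by rewrite eqxx.
  rewrite -mcoeff_msupp => /msize_mdeg_lt lt.
  have -> : mdeg m = (mdeg (m - lcmset s) + mdeg (lcmset s))%N by rewrite -mdegD submK.
  rewrite /D ltnS; apply: leq_add.
    apply: ltnW; apply: leq_trans lt _; apply: leq_trans (leq_bigmax s).
    exact: leq_bigmax.
  have : (lcmset s <= lcmset setT)%MM by rewrite lcmset_mono ?subsetT.
  by move=> /mnm_lepP le'; rewrite !mdegE leq_sum.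
have fu m c s : f m c s != 0 -> exists s', piece m u c s' != 0.
  rewrite /f; case: pickP => [v _|]; last by rewrite eqxx.
  case: ifP => _; last by rewrite eqxx.
  rewrite /htp; case: ifP => _; last by rewrite eqxx.
  by move=> ne; exists (s :\ v); apply: contraNneq ne => ->; rewrite mulr0.
have [w [wf wE]] : exists w, (forall m c s, s \subset [set v | (g v <= m)%MM] ->
  piece m w c s = f m c s)
    /\ forall s c a, (w s ord0 c)@_a = f (a + lcmset s)%MM c s.
  by apply: (@piece_assemble D) => m c s /fu[s' /hD].
exists w; split.
- move=> s sp; apply/rowP => c; apply/mpolyP => a; rewrite wE mxE mcoeff0 /f.
  case: pickP => [v _|//]; case: ifP => // _; rewrite /htp; case: ifP => // vs.
  rewrite piece0 ?mulr0 //; apply: up; apply: contraNneq sp.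
  by rewrite (cardsD1 v s) vs add1n => ->.
- apply: piece_eq => m c t tW; rewrite piece_taylor_bd //.
  set W := [set v | _] in tW *.
  (* If no generator divides [m] there is nothing to contract onto, but then [uv] makes [u] vanish
     in this multidegree. *)
  have [v0 v0m|none] := pickP (fun v => g v <= m)%MM; last first.
    rewrite /bd big1; last by move=> v; rewrite !inE none andbF.
    apply/esym/eqP; apply: contraT => /uv[v]; by rewrite none.
  pose v := odflt v0 [pick v | (g v <= m)%MM].
  have vm : (g v <= m)%MM by rewrite /v; case: pickP => //= /(_ v0); rewrite v0m.
  have vW : v \in W by rewrite inE.
  rewrite -[RHS](@bd_htp _ _ W v) // [X in _ = _ + X](_ : _ = 0) ?addr0.
    apply: eq_bd => x xW; have xtW : x |: t \subset W by rewrite subUset sub1set xW.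
    rewrite wf // /f lcmset_le xtW /v.
    by case: pickP => [//|/(_ v0)]; rewrite v0m.
  rewrite /htp; case: ifP => // vt.
  have tvW : t :\ v \subset W by apply: subset_trans tW; exact: subD1set.
  rewrite -piece_taylor_bd // piece0 ?mulr0 //.
- move=> m c s; rewrite /piece; case: ifP => le; last by rewrite eqxx.
  by rewrite wE submK // => /fu[s' /uP].
Qed.

End Chains.
End Multidegree.

(** * The Taylor resolution *)

Lemma taylor_bd_supp (K : fieldType) n N (g : 'I_N -> 'X_{1..n}) r p
    (u : {set 'I_N} -> 'rV[{mpoly K[n]}]_r) :
  (forall s : {set 'I_N}, #|s| != p.+1 -> u s = 0) ->
  forall t : {set 'I_N}, #|t| != p -> taylor_bd g u t = 0.
Proof.
move=> up t tp; rewrite /taylor_bd big1 // => v; rewrite inE => vt.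
by rewrite up ?scaler0 // cardsU1 vt add1n eqSS.
Qed.

Section Taylor.
Variables (K : fieldType) (n N : nat) (g : 'I_N -> 'X_{1..n}).
Local Notation S := {mpoly K[n]}.
Local Notation lcms := (lcmset g).
Implicit Types (s t : {set 'I_N}).

Definition subsets p : {set {set 'I_N}} := [set s : {set 'I_N} | #|s| == p].

(** A row indexed by the [p]-subsets becomes a function on all subsets; the sum has at most one term
    and is 0 off [subsets p]. *)
Definition chain_of p (u : 'rV[S]_#|subsets p|) s : 'rV[S]_1 :=
  const_mx (\sum_(a | enum_val a == s) u ord0 a).

Definition row_of p (w : {set 'I_N} -> 'rV[S]_1) : 'rV[S]_#|subsets p| :=
  \row_a w (enum_val a) ord0 ord0.

Definition taylor_coef s t : S :=
  \sum_(v | (v \notin t) && (v |: t == s)) sgn K v t *: 'X_[lcms s - lcms t].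

Lemma chain_of_val p (u : 'rV[S]_#|subsets p|) a :
  chain_of u (enum_val a) ord0 ord0 = u ord0 a.
Proof.
rewrite mxE (bigD1 a) //= big1 ?addr0 // => b /andP[/eqP/enum_val_inj ->].
by rewrite eqxx.
Qed.

Lemma chain_of_supp p (u : 'rV[S]_#|subsets p|) s : #|s| != p -> chain_of u s = 0.
Proof.
move=> sp; apply/rowP => c; rewrite !mxE big1 // => a /eqP as_.
by move: sp; rewrite -as_; have := enum_valP a; rewrite inE => ->.
Qed.

Lemma row_ofK p (w : {set 'I_N} -> 'rV[S]_1) :
  (forall s, #|s| != p -> w s = 0) -> chain_of (row_of p w) =1 w.
Proof.
move=> wp s; have [/eqP sp|/[dup] sp /wp ->] := boolP (#|s| == p);
  last exact: chain_of_supp.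
have sA : s \in subsets p by rewrite inE sp.
rewrite -(enum_rankK_in sA sA); apply/rowP => c; rewrite (ord1 c) chain_of_val.
by rewrite mxE.
Qed.

Lemma taylor_coefE p (u : 'rV[S]_#|subsets p|) t :
  \sum_a u ord0 a * taylor_coef (enum_val a) t = taylor_bd g (chain_of u) t ord0 ord0.
Proof.
rewrite /taylor_bd summxE.
under eq_bigr do rewrite /taylor_coef big_distrr /=.
rewrite (exchange_big_dep (fun v => v \notin t)) /=; last by move=> a v _ /andP[].
apply: eq_big => [v|v vt]; first by rewrite inE.
rewrite !mxE big_distrr /=; apply: eq_big => [a|a /andP[_ /eqP av]].
  by rewrite vt eq_sym.
by rewrite -av mulrC.
Qed.

Lemma taylor_coef_homog s t :
  zhomog ((mdeg (lcms s))%:Z - (mdeg (lcms t))%:Z) (taylor_coef s t).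
Proof.
move=> m; rewrite mcoeff_msupp raddf_sum /= => nz.
have [v /andP[_ /eqP vs] /= {}nz] : exists2 v, (v \notin t) && (v |: t == s) &
    (sgn K v t *: 'X_[lcms s - lcms t] : S)@_m != 0.
  apply/exists_inP; apply: contraNT nz => /exists_inPn h; apply/eqP.
  by apply: big1 => v /h/negPn/eqP.
have le : (lcms t <= lcms s)%MM by rewrite lcmset_mono // -vs subsetUr.
move: nz; rewrite mcoeffZ mcoeffX; case: (eqVneq _ m) => [<- _|_]; last first.
  by rewrite mulr0 eqxx.
by rewrite -{2}(submK le) mdegD PoszD addrK.
Qed.

(** The sets involved have size [p.+1 > 0], so each multidegree that occurs is divisible by some
    generator. *)
Lemma chain_exact p (u : 'rV[S]_#|subsets p.+1|) :
  (forall t, #|t| = p -> taylor_bd g (chain_of u) t ord0 ord0 = 0) ->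
  exists w : 'rV[S]_#|subsets p.+2|, taylor_bd g (chain_of w) =1 chain_of u.
Proof.
move=> ubd.
have [||||w [wsupp wu _]] := @taylor_bd_exact K n N g 1 p.+1 (chain_of u) (fun _ _ =>
  True).
- by move=> s; exact: chain_of_supp.
- move=> t; have [/eqP tp|] := boolP (#|t| == p).
    by apply/rowP => c; rewrite (ord1 c) ubd // mxE.
  by apply: taylor_bd_supp => s; exact: chain_of_supp.
- by [].
- move=> m c s; have [sp|/chain_of_supp /piece0 ->] := boolP (#|s| == p.+1);
  last by rewrite eqxx.
  rewrite /piece; case: ifP => [le _|]; last by rewrite eqxx.
  have /card_gt0P[v vs] : (0 < #|s|)%N by rewrite (eqP sp).
  by exists v; move: le; rewrite lcmset_le => /subsetP/(_ v vs); rewrite inE.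
by exists (row_of p.+2 w) => t; rewrite -wu; apply: eq_taylor_bd; exact: row_ofK.
Qed.

Definition taylor_diff p : 'M[S]_(#|subsets p.+1|, #|subsets p|) :=
  \matrix_(a, b) taylor_coef (enum_val a) (enum_val b).

Lemma mul_taylor_diff p (u : 'rV[S]_#|subsets p.+1|) :
  chain_of (u *m taylor_diff p) =1 taylor_bd g (chain_of u).
Proof.
move=> t; have [/eqP tp|tp] := boolP (#|t| == p); last first.
  by rewrite chain_of_supp // (@taylor_bd_supp _ _ _ _ _ p) // => s; exact: chain_of_supp.
have tA : t \in subsets p by rewrite inE tp.
rewrite -(enum_rankK_in tA tA); apply/rowP => c; rewrite (ord1 c) chain_of_val.
by rewrite -taylor_coefE mxE; apply: eq_bigr => a _; rewrite mxE.
Qed.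

Lemma taylor_diff_exact p (u : 'rV[S]_#|subsets p.+1|) :
  (forall t, #|t| = p -> taylor_bd g (chain_of u) t ord0 ord0 = 0) <->
  exists w, u = w *m taylor_diff p.+1.
Proof.
split=> [/chain_exact[w wu]|[w ->] t _]; last first.
  by rewrite (eq_taylor_bd g (mul_taylor_diff w)) taylor_bd_taylor_bd mxE.
exists w; apply/rowP => a.
by rewrite -[LHS]chain_of_val -[RHS]chain_of_val mul_taylor_diff wu.
Qed.

Variable I : S -> Prop.
Hypothesis I_gen :
  forall f, I f <-> exists c : 'I_N -> S, f = \sum_v c v * 'X_[g v].

Definition taylor_aug : 'cV[S]_#|subsets 1| :=
  \col_a taylor_coef (enum_val a) set0.

Lemma mul_taylor_aug (u : 'rV[S]_#|subsets 1|) :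
  (u *m taylor_aug) ord0 ord0 = taylor_bd g (chain_of u) set0 ord0 ord0.
Proof. by rewrite -taylor_coefE mxE; apply: eq_bigr => a _; rewrite mxE. Qed.

Lemma lcms1 v : lcms [set v] = g v.
Proof. by apply/mnmP => i; rewrite mnmE big_set1. Qed.

Lemma taylor_bd_at0 (w : {set 'I_N} -> 'rV[S]_1) :
  taylor_bd g w set0 ord0 ord0 = \sum_v w [set v] ord0 ord0 * 'X_[g v].
Proof.
rewrite /taylor_bd summxE; apply: eq_big => [v|v _]; first by rewrite !inE.
by rewrite mxE setU0 lcms1 lcmset0 subm0 sgn0 scale1r mulrC.
Qed.

Lemma taylor_aug_image f :
  I f <-> exists u : 'rV_#|subsets 1|, (u *m taylor_aug) ord0 ord0 = f.
Proof.
rewrite I_gen; split=> [[c ->]|[u <-]]; last first.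
  by rewrite mul_taylor_aug taylor_bd_at0; exists (fun v => chain_of u [set v] ord0 ord0).
pose w s : 'rV[S]_1 := const_mx (\sum_(v | [set v] == s) c v).
have wsupp s : #|s| != 1%N -> w s = 0.
  move=> s1; apply/rowP => x; rewrite !mxE big1 // => v /eqP sv.
  by rewrite -sv cards1 in s1.
exists (row_of 1 w); rewrite mul_taylor_aug (eq_taylor_bd g (row_ofK wsupp))
  taylor_bd_at0.
apply: eq_bigr => v _; rewrite mxE (bigD1 v) //= big1 ?addr0 // =>
  x /andP[/eqP/set1_inj ->].
by rewrite eqxx.
Qed.

(** Dropping the empty set from the Taylor complex of [S/I] leaves a resolution of [I], with the
    subsets of size [i + 1] in position [i]. It witnesses the existential in [tor_neq0]. *)
Definition taylor_resolution : graded_free_resolution I.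
Proof.
apply: (@GradedFreeResolution K n I (fun i => #|subsets i.+1|)
  (fun i a => (mdeg (lcms (enum_val a)))%:Z) taylor_aug (fun i => taylor_diff i.+1)).
- move=> a; have := @taylor_coef_homog (enum_val a) set0.
  by rewrite lcmset0 mdeg0 subr0 mxE.
- by move=> i a b; rewrite mxE; exact: taylor_coef_homog.
- exact: taylor_aug_image.
- move=> u; rewrite -taylor_diff_exact; split=> [u0 t /eqP|u0].
    by rewrite cards_eq0 => /eqP ->; rewrite -mul_taylor_aug u0 mxE.
  by apply/rowP => c; rewrite (ord1 c) mul_taylor_aug u0 ?cards0 // mxE.
- move=> i u; rewrite -taylor_diff_exact; split=> [u0 t tp|u0].
    by rewrite -mul_taylor_diff u0 mxE big1 // => a _; rewrite mxE.
  apply/rowP => a; rewrite -chain_of_val mul_taylor_diff u0 ?mxE //.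
  by have := enum_valP a; rewrite inE => /eqP.
Defined.

End Taylor.

(** * Balancing a double complex *)

Definition is_cycle (A : nat -> zmodType) (d : forall i, A i.+1 -> A i) i : A i -> Prop :=
  match i return A i -> Prop with
  | 0 => fun _ => True
  | i'.+1 => fun a => d i' a = 0
  end.

(** The predicate [M] cuts out the elements of one internal degree, which avoids forming
    subgroups. *)
Definition acyclic_at (A : nat -> zmodType) (M : forall i, A i -> Prop)
    (d : forall i, A i.+1 -> A i) i :=
  forall a : A i, M i a -> is_cycle d a -> exists2 a' : A i.+1, M i.+1 a' & d i a' = a.

Section Balancing.
(** A first-quadrant double complex with commuting differentials: [dX] lowers [p] and is augmented
    to [A], [eX] lowers [q] and is augmented to [B]. Both augmented directions are exact. *)
Variables (X : nat -> nat -> zmodType) (A B : nat -> zmodType).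
Variables (MX : forall p q, X p q -> Prop) (MA : forall q, A q ->
  Prop) (MB : forall p, B p -> Prop).
Variables (dX : forall p q, X p.+1 q -> X p q) (eX : forall p q, X p q.+1 -> X p q).
Variables (augA : forall q, X 0%N q -> A q) (augB : forall p, X p 0%N -> B p).
Variables (dA : forall q, A q.+1 -> A q) (dB : forall p, B p.+1 -> B p).

Hypothesis MXB : forall p q (x y : X p q), MX x -> MX y -> MX (x - y).
Hypothesis dXM : forall p q (x : X p.+1 q), MX x -> MX (dX x).
Hypothesis eXM : forall p q (x : X p q.+1), MX x -> MX (eX x).
Hypothesis augAM : forall q (x : X 0%N q), MX x -> MA (augA x).
Hypothesis augBM : forall p (x : X p 0%N), MX x -> MB (augB x).
Hypothesis dXD : forall p q (x y : X p.+1 q), dX (x + y) = dX x + dX y.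
Hypothesis eXB : forall p q (x y : X p q.+1), eX (x - y) = eX x - eX y.
Hypothesis augBB : forall p (x y : X p 0%N), augB (x - y) = augB x - augB y.
Hypothesis augAD : forall q (x y : X 0%N q), augA (x + y) = augA x + augA y.
Hypothesis dXeX : forall p q (x : X p.+1 q.+1), dX (eX x) = eX (dX x).
Hypothesis dA_aug : forall q (x : X 0%N q.+1), dA (augA x) = augA (eX x).
Hypothesis dB_aug : forall p (x : X p.+1 0%N), dB (augB x) = augB (dX x).
Hypothesis dXdX : forall p q (x : X p.+2 q), dX (dX x) = 0.
Hypothesis eXeX : forall p q (x : X p q.+2), eX (eX x) = 0.
Hypothesis augB_eX : forall p (x : X p 1%N), augB (eX x) = 0.
Hypothesis augA_dX : forall q (x : X 1%N q), augA (dX x) = 0.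
Hypothesis augA_surj : forall q (a : A q), MA a -> exists2 x, MX x & augA x = a.
Hypothesis augB_surj : forall p (b : B p), MB b -> exists2 x, MX x & augB x = b.
Hypothesis exA0 : forall q (x : X 0%N q), MX x -> augA x = 0 ->
  exists2 y, MX y & dX y = x.
Hypothesis exA : forall p q (x : X p.+1 q), MX x -> dX x = 0 ->
  exists2 y, MX y & dX y = x.
Hypothesis exB0 : forall p (x : X p 0%N), MX x -> augB x = 0 ->
  exists2 y, MX y & eX y = x.
Hypothesis exB : forall p q (x : X p q.+1), MX x -> eX x = 0 ->
  exists2 y, MX y & eX y = x.

Definition aug_dX p q : X p q -> Prop :=
  match p return X p q -> Prop with
  | 0 => fun x => augA x = 0
  | p'.+1 => fun x => dX x = 0
  end.

Lemma aug_dX_exact p q (x : X p q) : MX x -> aug_dX x -> exists2 y, MX y & dX y = x.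
Proof. by case: p x => [|p] x /=; [exact: exA0 | exact: exA]. Qed.

(** The condition for one more step of the staircase: [eX x] lifts along [dX]. At the end of the
    staircase, [augB x] must be a cycle. *)
Definition pre_cycle p q : X p q -> Prop :=
  match q return X p q -> Prop with
  | 0 => fun x => is_cycle dB (augB x)
  | q'.+1 => fun x => aug_dX (eX x)
  end.

(* The staircase of the double complex, climbed up and down by one induction. *)
Lemma pre_cycle_split q p (x : X p q) :
  acyclic_at MB dB (p + q) -> MX x -> pre_cycle x ->
  exists z, exists y, [/\ MX (z : X p.+1 q), MX (y : X p q.+1) & x = dX z + eX y].
Proof.
elim: q p x => [|q IHq] p x Bpq Mx /= cx.
  rewrite addn0 in Bpq; have [b' Mb' bE] := Bpq _ (augBM Mx) cx.
  have [z Mz zE] := augB_surj Mb'.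
  have [||y My yE] := @exB0 p (x - dX z).
  - by apply: MXB => //; apply: dXM.
  - by rewrite augBB -dB_aug zE bE subrr.
  by exists z, y; split=> //; rewrite yE addrC subrK.
(* The lift [x'] of [eX x] has the same total degree with smaller [q]. If [x' = dX z + eX y], then
   [eX] kills [x - dX y], so that element lifts along [eX]. *)
have [x' Mx' x'E] := aug_dX_exact (eXM Mx) cx.
have [||z [y [Mz My x'E2]]] := IHq p.+1 x' _ Mx'.
- by rewrite addSnnS.
- by case: q x x' x'E {IHq Mx' Bpq Mx cx} => [|q] x x' x'E /=;
    rewrite ?dB_aug ?dXeX x'E ?augB_eX ?eXeX.
have [||w Mw wE] := @exB p q (x - dX y).
- by apply: MXB => //; apply: dXM.
- by rewrite eXB -dXeX -x'E x'E2 dXD dXdX add0r subrr.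
by exists y, w; split=> //; rewrite wE addrC subrK.
Qed.

(** Lift a cycle of [A] to [x] and split [x = dX z + eX y]. The augmentation kills the first
    summand, so the cycle is the boundary of [augA y]. *)
Lemma acyclic_balance q : acyclic_at MB dB q -> acyclic_at MA dA q.
Proof.
move=> Bq a Ma ca; have [x Mx xE] := augA_surj Ma.
have [|z [y [Mz My xE2]]] := @pre_cycle_split q 0%N x Bq Mx.
  by case: q x a xE ca {Bq Ma Mx} => [|q] x a xE //= ca; rewrite -dA_aug xE.
by exists (augA y); [exact: augAM | rewrite dA_aug -xE xE2 augAD augA_dX add0r].
Qed.

End Balancing.

(** * Graded Koszul complexes *)

Section Homogeneous.
Variables (K : fieldType) (n : nat).
Local Notation S := {mpoly K[n]}.
Implicit Types (p q : S) (d e : int).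

Lemma zhomogP d p : zhomog d p <-> forall m, p@_m != 0 -> (mdeg m)%:Z = d.
Proof. by split=> h m; have := h m; rewrite mcoeff_msupp. Qed.

Lemma zhomog0 d : zhomog d (0 : S).
Proof. by apply/zhomogP => m; rewrite mcoeff0 eqxx. Qed.

Lemma zhomogD d p q : zhomog d p -> zhomog d q -> zhomog d (p + q).
Proof.
move=> /zhomogP hp /zhomogP hq; apply/zhomogP => m; rewrite mcoeffD.
have [->|/hp //] := eqVneq (p@_m) 0; rewrite add0r; exact: hq.
Qed.

Lemma zhomogN d p : zhomog d p -> zhomog d (- p).
Proof. by move=> /zhomogP hp; apply/zhomogP => m; rewrite mcoeffN oppr_eq0 => /hp. Qed.

Lemma zhomog_sum (T : Type) (r : seq T) (P : pred T) (F : T -> S) d :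
  (forall i, P i -> zhomog d (F i)) -> zhomog d (\sum_(i <- r | P i) F i).
Proof. by move=> h; elim/big_ind: _ => //; [exact: zhomog0 | exact: zhomogD]. Qed.

Lemma zhomogM d e p q : zhomog d p -> zhomog e q -> zhomog (d + e) (p * q).
Proof.
move=> hp hq m /msuppM_le /allpairsP[[a b] /= [/hp <- /hq <- ->]].
by rewrite mdegD.
Qed.

Lemma zhomogZX (c : K) (m : 'X_{1..n}) : zhomog (mdeg m)%:Z (c *: 'X_[m]).
Proof.
apply/zhomogP => a; rewrite mcoeffZ mcoeffX; case: (eqVneq m a) => [->|_] //.
by rewrite mulr0 eqxx.
Qed.

Definition zpart d p : S := \sum_(m <- msupp p | (mdeg m)%:Z == d) p@_m *: 'X_[m].

Lemma mcoeff_zpart d p m : (zpart d p)@_m = if (mdeg m)%:Z == d then p@_m else 0.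
Proof.
rewrite /zpart raddf_sum /=; under eq_bigr do rewrite mcoeffZ mcoeffX.
have [ms|ms] := boolP (m \in msupp p); last first.
  rewrite (memN_msupp_eq0 ms) if_same big_seq_cond big1 // => a /andP[ams _].
  by case: eqVneq => [am|_]; [rewrite -am ams in ms | rewrite mulr0].
rewrite big_mkcond /= (bigD1_seq m) ?msupp_uniq //= eqxx mulr1 big1 ?addr0 // => a.
by move=> /negPf ->; rewrite mulr0 if_same.
Qed.

Lemma zpart_homog d p : zhomog d (zpart d p).
Proof. by apply/zhomogP => m; rewrite mcoeff_zpart; case: ((mdeg m)%:Z =P d) => [//|_];
  rewrite eqxx. Qed.

Lemma zpartD d : {morph zpart d : p q / p + q}.
Proof.
move=> p q; apply/mpolyP => m; rewrite mcoeffD !mcoeff_zpart.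
by case: ifP; rewrite ?mcoeffD ?addr0.
Qed.

Lemma zpart0 d : zpart d 0 = 0.
Proof. by rewrite /zpart msupp0 big_nil. Qed.

Lemma zpart_zhomog d e p : zhomog e p -> zpart d p = if d == e then p else 0.
Proof.
move=> /zhomogP hp; apply/mpolyP => m; rewrite mcoeff_zpart.
case: (eqVneq (p@_m) 0) => [p0|/hp ->].
  by rewrite p0 if_same; case: ifP => _; rewrite ?p0 ?mcoeff0.
by rewrite eq_sym; case: ifP => _; rewrite ?mcoeff0.
Qed.

Lemma zpartM d e p q : zhomog e q -> zpart d (p * q) = zpart (d - e) p * q.
Proof.
move=> hq; have addz x (F : 'X_{1..n} -> S) :
    zpart x (\sum_(m <- msupp p) F m) = \sum_(m <- msupp p) zpart x (F m).
  by apply: (big_morph (zpart x)); [exact: zpartD | exact: zpart0].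
rewrite (mpolyE p) big_distrl /= !addz big_distrl /=; apply: eq_bigr => m _.
rewrite (zpart_zhomog _ (zhomogM (@zhomogZX p@_m m) hq)).
rewrite (zpart_zhomog _ (@zhomogZX p@_m m)) subr_eq.
by case: ifP => _; rewrite ?mul0r.
Qed.

(** Keeping in each coordinate only the component of the right degree does not change a homogeneous
    image. *)
Lemma homogeneous_preimage r r' (M : 'M[S]_(r', r)) (sh' : 'I_r' -> int)
    (sh : 'I_r -> int) d (w : 'rV[S]_r') :
  (forall a b, zhomog (sh' a - sh b) (M a b)) ->
  (forall b, zhomog (d - sh b) ((w *m M) ord0 b)) ->
  exists2 w' : 'rV[S]_r', forall a, zhomog (d - sh' a) (w' ord0 a) & w *m M = w' *m M.
Proof.
move=> hM hw; exists (\row_a zpart (d - sh' a) (w ord0 a)) => [a|].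
  by rewrite mxE; exact: zpart_homog.
apply/rowP => b; transitivity (zpart (d - sh b) ((w *m M) ord0 b)).
  by rewrite (zpart_zhomog _ (hw b)) eqxx.
rewrite !mxE (big_morph (zpart (d - sh b)) (@zpartD _) (@zpart0 _)).
apply: eq_bigr => a _; rewrite (zpartM _ _ (hM a b)) mxE.
by congr (zpart _ _ * _); ring.
Qed.

End Homogeneous.

Section Koszul.
Variables (K : fieldType) (n : nat).
Local Notation S := {mpoly K[n]}.

Definition kvar (v : 'I_n) : 'X_{1..n} := U_(v)%MM.

Lemma kvar_lcm (s : {set 'I_n}) i : lcmset kvar s i = (i \in s).
Proof.
rewrite mnmE; apply/eqP; rewrite eqn_leq; apply/andP; split.
  apply/bigmax_leqP => v vs; rewrite mnm1E; case: eqVneq => [<-|//]; by rewrite vs.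
case: (boolP (i \in s)) => // is_.
by apply: leq_trans (@leq_bigmax_cond _ _ (fun v => kvar v i) i is_); rewrite mnm1E eqxx.
Qed.

Lemma mdeg_kvar (s : {set 'I_n}) : mdeg (lcmset kvar s) = #|s|.
Proof.
by rewrite mdegE -sum1_card [RHS]big_mkcond; apply: eq_bigr => i _; rewrite kvar_lcm;
  case: (i \in s).
Qed.

Lemma kvar_lcmD v (t : {set 'I_n}) : v \notin t ->
  (lcmset kvar (v |: t) - lcmset kvar t)%MM = U_(v)%MM.
Proof.
move=> vt; apply/mnmP => i; rewrite mnmBE !kvar_lcm !inE mnm1E eq_sym.
by case: eqVneq => [<-|_]; rewrite ?(negPf vt) ?subn0 //= subnn.
Qed.

Lemma kvar_le v (m : 'X_{1..n}) : (kvar v <= m)%MM = (0 < m v)%N.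
Proof. by rewrite lep1mP lt0n. Qed.

Section Graded.
Variables (j : int) (r : nat) (sh : 'I_r -> int).

Implicit Types (u w : {ffun {set 'I_n} -> 'rV[S]_r}) (p : nat).

(** Koszul [p]-chains of internal degree [j] with values in the sum of the [S(- sh a)]; the basis
    element of a [p]-set accounts for [p] of the degree. *)
Definition kchain p (u : {ffun {set 'I_n} -> 'rV[S]_r}) :=
  (forall s : {set 'I_n}, #|s| != p -> u s = 0) /\
  (forall s a, zhomog (j - p%:Z - sh a) (u s ord0 a)).

Definition kdiff (u : {ffun {set 'I_n} -> 'rV[S]_r}) : {ffun {set 'I_n} -> 'rV[S]_r} :=
  [ffun t => taylor_bd kvar u t].

Lemma kchainB p u w : kchain p u -> kchain p w -> kchain p (u - w).
Proof.
move=> [us uh] [ws wh]; split=> [s sp|s a]; rewrite !ffunE.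
  by rewrite us // ws // subrr.
by rewrite !mxE; apply: zhomogD => //; apply: zhomogN.
Qed.

Lemma kdiff_chain p u : kchain p.+1 u -> kchain p (kdiff u).
Proof.
move=> [us uh]; split=> [s sp|s a]; rewrite !ffunE; first exact: taylor_bd_supp us _ sp.
rewrite /taylor_bd summxE; apply: zhomog_sum => v; rewrite inE => vs; rewrite mxE.
have -> : j - p%:Z - sh a = (mdeg U_(v)%MM)%:Z + (j - p.+1%:Z - sh a).
  by rewrite mdeg1 -addn1 PoszD; ring.
by apply: zhomogM; [rewrite -(kvar_lcmD vs); exact: zhomogZX | exact: uh].
Qed.

Lemma kdiffB u w : kdiff (u - w) = kdiff u - kdiff w.
Proof.
apply/ffunP => t; rewrite !ffunE -taylor_bdB; apply: eq_taylor_bd => s; by rewrite !ffunE.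
Qed.

Lemma kdiffD u w : kdiff (u + w) = kdiff u + kdiff w.
Proof.
by apply/eqP; rewrite -subr_eq -kdiffB addrK.
Qed.

Lemma kdiff_kdiff u : kdiff (kdiff u) = 0.
Proof.
apply/ffunP => t; rewrite !ffunE -[RHS](taylor_bd_taylor_bd kvar u t).
by apply: eq_taylor_bd => s; rewrite ffunE.
Qed.

Lemma kchain_piece p u m a s : kchain p u -> piece kvar m u a s != 0 ->
  [/\ (mdeg m)%:Z = j - sh a, #|s| = p & (u s ord0 a)@_(m - lcmset kvar s) != 0].
Proof.
move=> [us uh]; have [sp|/us /piece0 ->] := boolP (#|s| == p); last by rewrite eqxx.
rewrite /piece; case: ifP => [le nz|]; last by rewrite eqxx.
rewrite (eqP sp); split=> //; have /zhomogP/(_ _ nz) := uh s a.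
rewrite -{2}(submK le) mdegD mdeg_kvar (eqP sp) PoszD => ->; ring.
Qed.

Lemma kchainP p u : (forall s : {set 'I_n}, #|s| != p -> u s = 0) ->
  (forall m a s, piece kvar m u a s != 0 -> (mdeg m)%:Z = j - sh a) -> kchain p u.
Proof.
move=> us up; split=> // s a; have [sp|/us ->] := boolP (#|s| == p); last first.
  by rewrite mxE; exact: zhomog0.
apply/zhomogP => m nz; have := up (m + lcmset kvar s)%MM a s.
rewrite /piece lem_addl addmK mdegD mdeg_kvar (eqP sp) PoszD => /(_ nz); lia.
Qed.

Lemma kdiff_exact p u : kchain p u -> kdiff u = 0 ->
  (p = 0%N -> forall a, (u set0 ord0 a)@_0 = 0) ->
  exists2 w, kchain p.+1 w & kdiff w = u.
Proof.
move=> uk du u0.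
have [||||w [ws wu wm]] := @taylor_bd_exact K n n kvar r p u (fun m a =>
  (mdeg m)%:Z = j - sh a).
- by case: uk.
- by move=> t; have /ffunP/(_ t) := du; rewrite !ffunE.
- by move=> m a s /(kchain_piece uk)[].
- move=> m a s /[dup] nz /(kchain_piece uk)[_ sp _].
  (* Only multidegree 0 is divisible by no variable; it involves just the constant coefficient at
     the empty set, which is 0 by [u0]. *)
  have [v vm|m0] := pickP (fun v => kvar v <= m)%MM; first by exists v.
  case/eqP: nz; have {m0}-> : m = 0%MM.
    by apply/mnmP => v; have := m0 v; rewrite kvar_le mnm0E; case: (m v).
  rewrite /piece; case: ifP => // le; have s0 : s = set0.
    apply/setP => v; move: le; rewrite lcmset_le inE => /subsetP/(_ v).
    by rewrite inE kvar_le mnm0E; case: (v \in s) => // /(_ isT).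
  by rewrite s0 lcmset0 subm0 u0 // -sp s0 cards0.
exists (finfun w).
  apply: kchainP => [s sp|m a s]; first by rewrite ffunE ws.
  by rewrite /piece ffunE; exact: wm.
apply/ffunP => t; rewrite ffunE -wu; apply: eq_taylor_bd => s; by rewrite ffunE.
Qed.

End Graded.
End Koszul.

(** * Tor as Koszul homology *)

Section Balance.
Variables (K : fieldType) (n : nat) (I : {mpoly K[n]} -> Prop).
Variable F : graded_free_resolution I.
Variable j : int.
Local Notation S := {mpoly K[n]}.
Local Notation chains r := {ffun {set 'I_n} -> 'rV[S]_r}.

Definition kideal p (b : chains 1) :=
  kchain j (fun _ => 0) p b /\ forall s, I (b s ord0 ord0).

(** Koszul [p]-chains with values in [F_q]. Along the Koszul differential the augmentation is to
    [F_q] tensored with [K], along the resolution it is to Koszul chains with values in [I]. *)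
Let X (p q : nat) : zmodType := chains (grank F q).
Let MX p q (x : X p q) := kchain j (@gshift _ _ _ F q) p x.
Let A q : zmodType := 'rV[K]_(grank F q).
Let MA q (a : A q) := in_degree j a.
Let B (p : nat) : zmodType := chains 1.
Let MB p (b : B p) := kideal p b.
Let dX p q (x : X p.+1 q) : X p q := kdiff x.
Let eX p q (x : X p q.+1) : X p q := [ffun s => x s *m gdiff F q].
Let augA q (x : X 0%N q) : A q := map_mx (fun f : S => f@_0%MM) (x set0).
Let augB p (x : X p 0%N) : B p := [ffun s => x s *m gaug F].
Let dA q (a : A q.+1) : A q := a *m diffK F q.
Let dB p (b : B p.+1) : B p := kdiff b.

Let kdiff_mulmx r r' (M : 'M[S]_(r, r')) (x : chains r) :
  kdiff [ffun s => x s *m M] = [ffun s => kdiff x s *m M].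
Proof.
apply/ffunP => t; rewrite !ffunE /taylor_bd mulmx_suml; apply: eq_bigr => v _.
by rewrite ffunE scalemxAl.
Qed.

Let mulmx_chain r r' (M : 'M[S]_(r, r')) (sh : 'I_r -> int) (sh' : 'I_r' -> int)
  p (x : chains r) : (forall a b, zhomog (sh a - sh' b) (M a b)) ->
  kchain j sh p x -> kchain j sh' p [ffun s => x s *m M].
Proof.
move=> hM [xs xh]; split=> [s sp|s b]; rewrite ffunE; first by rewrite xs ?mul0mx.
rewrite mxE; apply: zhomog_sum => a _.
have -> : j - p%:Z - sh' b = (j - p%:Z - sh a) + (sh a - sh' b) by ring.
exact: zhomogM.
Qed.

Let lift_chain r r' (M : 'M[S]_(r, r')) (sh : 'I_r -> int) (sh' : 'I_r' -> int)
  p (x : chains r') : (forall a b, zhomog (sh a - sh' b) (M a b)) ->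
  kchain j sh' p x -> (forall s, exists w, x s = w *m M) ->
  exists2 y : chains r, kchain j sh p y & [ffun s => y s *m M] = x.
Proof.
move=> hM [xs xh] ex.
have /choice[y yP] : forall s : {set 'I_n}, exists w : 'rV[S]_r,
    (#|s| != p -> w = 0) /\ (forall a,
      zhomog (j - p%:Z - sh a) (w ord0 a)) /\ x s = w *m M.
  move=> s; have [sp|/xs ->] := boolP (#|s| == p); last first.
    by exists 0; rewrite mul0mx; split=> //; split=> // a; rewrite mxE; exact: zhomog0.
  have [w xw] := ex s; have := xh s; rewrite xw => hw.
  by have [w' w'h ->] := homogeneous_preimage hM hw; exists w'.
exists (finfun y); first by split=> [s sp|s a]; rewrite ffunE;
  have [h1 [h2 h3]] := yP s; auto.
by apply/ffunP => s; rewrite !ffunE; have [_ [_ ->]] := yP s.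
Qed.

Let aug_homog a b : zhomog (gshift a - 0) (gaug F a b).
Proof. by rewrite subr0 (ord1 b); exact: gaug_homog. Qed.

Let MXB p q (x y : X p q) : MX x -> MX y -> MX (x - y).
Proof. exact: kchainB. Qed.
Let dXM p q (x : X p.+1 q) : MX x -> MX (dX x).
Proof. exact: kdiff_chain. Qed.
Let eXM p q (x : X p q.+1) : MX x -> MX (eX x).
Proof. by apply: mulmx_chain; exact: gdiff_homog. Qed.

Let augAM q (x : X 0%N q) : MX x -> MA (augA x).
Proof.
move=> [_ xh] a; rewrite mxE => nz.
by have /zhomogP/(_ _ nz) := xh set0 a; rewrite mdeg0; lia.
Qed.

Let augBM p (x : X p 0%N) : MX x -> MB (augB x).
Proof.
move=> Mx; split; first by apply: mulmx_chain Mx; exact: aug_homog.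
by move=> s; rewrite ffunE gaug_image; exists (x s).
Qed.

Let eXB p q (x y : X p q.+1) : eX (x - y) = eX x - eX y.
Proof. by apply/ffunP => s; rewrite !ffunE mulmxBl. Qed.
Let augBB p (x y : X p 0%N) : augB (x - y) = augB x - augB y.
Proof. by apply/ffunP => s; rewrite !ffunE mulmxBl. Qed.
Let eXD p q (x y : X p q.+1) : eX (x + y) = eX x + eX y.
Proof. by apply/ffunP => s; rewrite !ffunE mulmxDl. Qed.
Let augBD p (x y : X p 0%N) : augB (x + y) = augB x + augB y.
Proof. by apply/ffunP => s; rewrite !ffunE mulmxDl. Qed.
Let augAD q (x y : X 0%N q) : augA (x + y) = augA x + augA y.
Proof. by apply/rowP => a; rewrite !mxE ffunE mxE mcoeffD. Qed.
Let augAB q (x y : X 0%N q) : augA (x - y) = augA x - augA y.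
Proof. by apply/rowP => a; rewrite !mxE !ffunE !mxE mcoeffB. Qed.

Let dXeX p q (x : X p.+1 q.+1) : dX (eX x) = eX (dX x).
Proof. exact: kdiff_mulmx. Qed.
Let dB_aug p (x : X p.+1 0%N) : dB (augB x) = augB (dX x).
Proof. exact: kdiff_mulmx. Qed.
Let dA_aug q (x : X 0%N q.+1) : dA (augA x) = augA (eX x).
Proof.
apply/rowP => b; rewrite !mxE ffunE mxE raddf_sum /=; apply: eq_bigr => a _.
by rewrite !mxE (rmorphM (mcoeff 0%MM)).
Qed.

Let eXeX p q (x : X p q.+2) : eX (eX x) = 0.
Proof.
apply/ffunP => s; rewrite !ffunE; apply/(gexactS (i := q)); by exists (x s).
Qed.
Let augB_eX p (x : X p 1%N) : augB (eX x) = 0.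
Proof. by apply/ffunP => s; rewrite !ffunE; apply/gexact0; exists (x s). Qed.

Let augA_dX q (x : X 1%N q) : augA (dX x) = 0.
Proof.
apply/rowP => a; rewrite !mxE ffunE /taylor_bd summxE raddf_sum /= big1 // => v _.
rewrite mxE -scalerAl mcoeffZ mcoeffXM kvar_lcmD ?inE //.
by rewrite lep1mP mnm0E eqxx mulr0.
Qed.

Let augA_surj q (a : A q) : MA a -> exists2 x : X 0%N q, MX x & augA x = a.
Proof.
move=> Ma; exists [ffun s : {set 'I_n} =>
  if s == set0 then map_mx (@mpolyC n K) a else 0].
  split=> [s|s c]; rewrite ffunE; first by rewrite cards_eq0 => /negPf ->.
  case: eqP => [_|_]; last by rewrite mxE; exact: zhomog0.
  rewrite mxE; apply/zhomogP => m; rewrite mcoeffC; have [->|_] := eqVneq m 0%MM;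
    last by rewrite mulr0 eqxx.
  by rewrite mulr1 mdeg0 => /Ma; lia.
by apply/rowP => c; rewrite !mxE ffunE eqxx mxE mpolyCK.
Qed.

Let augB_surj p (b : B p) : MB b -> exists2 x : X p 0%N, MX x & augB x = b.
Proof.
move=> [bc bI]; apply: (@lift_chain _ _ (gaug F) (@gshift _ _ _ F 0%N) (fun _ =>
  0) p b aug_homog bc) => s.
have [u uE] := (gaug_image F _).1 (bI s); exists u; apply/rowP => c.
by rewrite (ord1 c) uE.
Qed.

Let exA0 q (x : X 0%N q) : MX x -> augA x = 0 -> exists2 y : X 1%N q, MX y & dX y = x.
Proof.
move=> Mx x0; have d0 : kdiff x = 0.
  apply/ffunP => t; rewrite !ffunE /taylor_bd big1 // => v; rewrite inE => vt.
  by rewrite (proj1 Mx) ?scaler0 // -lt0n cardsU1 vt.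
have [_ a|y My yE] := kdiff_exact Mx d0; last by exists y.
by have /rowP/(_ a) := x0; rewrite !mxE.
Qed.

Let exA p q (x : X p.+1 q) : MX x -> dX x = 0 -> exists2 y : X p.+2 q, MX y & dX y = x.
Proof. by move=> Mx x0; apply: (kdiff_exact Mx x0). Qed.

Let exB0 p (x : X p 0%N) : MX x -> augB x = 0 -> exists2 y : X p 1%N, MX y & eX y = x.
Proof.
move=> Mx /ffunP x0; apply: (lift_chain (gdiff_homog (i := 0)) Mx) => s.
by apply/gexact0; have := x0 s; rewrite !ffunE.
Qed.

Let exB p q (x : X p q.+1) : MX x -> eX x = 0 -> exists2 y : X p q.+2, MX y & eX y = x.
Proof.
move=> Mx /ffunP x0; apply: (lift_chain (gdiff_homog (i := q.+1)) Mx) => s.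
by apply/gexactS; have := x0 s; rewrite !ffunE.
Qed.

Lemma acyclic_resolution_koszul i :
  acyclic_at (A := A) MA dA i <-> acyclic_at (A := B) MB dB i.
Proof.
split.
  (* The hypotheses of the balancing lemma are symmetric, so one implication is the other with the
     two indices exchanged. *)
  apply: (@acyclic_balance (fun p q => X q p) B A (fun p q => @MX q p) MB MA
    (fun p q => @eX q p) (fun p q => @dX q p) augB augA dB dA) => //.
  - by move=> p q x y; exact: MXB.
  - by move=> p q x; exact: eXM.
  - by move=> p q x; exact: dXM.
  - by move=> p q x y; exact: kdiffB.
  - by move=> p q x; exact: kdiff_kdiff.
  - by move=> p q x; exact: exB.
  - by move=> p q x; exact: exA.
apply: (@acyclic_balance X A B MX MA MB dX eX augA augB dA dB) => //.
- by move=> p q x y; exact: kdiffD.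
- by move=> p q x; exact: kdiff_kdiff.
Qed.

Lemma homology_neq0_acyclic i :
  homology_neq0 F i j <-> ~ acyclic_at (A := A) MA dA i.
Proof.
have cyc k (v : A k) : @Defs.cycle K n I F k v <-> is_cycle dA v by case: k v.
split=> [[v [vj vc nw]] ac|/existsNP[v /not_implyP[vj /not_implyP[vc nw]]]].
  have [w wj wv] := ac v vj ((cyc i v).1 vc).
  by apply: nw; exists w; split=> //; rewrite -wv.
exists v; split=> //.
by move=> [w [wj wv]]; apply: nw; exists w.
Qed.

Definition koszul_neq0 i := exists b : chains 1,
  [/\ kideal i b, kdiff b = 0 & ~ exists2 b' : chains 1, kideal i.+1 b' & kdiff b' = b].

Lemma homology_neq0_koszul i : homology_neq0 F i j <-> koszul_neq0 i.
Proof.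
rewrite homology_neq0_acyclic acyclic_resolution_koszul.
split=> [/existsNP[v /not_implyP[vj /not_implyP[vc nw]]]|[b [bi bd nw]] ac].
  (* In position 0 being a cycle is no condition, and [kdiff] kills a 0-chain because it lives on
     the empty set. *)
  exists v; split=> //; case: (i) vj vc => [[vj _] _|k _ //].
  apply/ffunP => t; rewrite !ffunE /taylor_bd big1 // => x; rewrite inE => vt.
  by rewrite (proj1 vj) ?scaler0 // -lt0n cardsU1 vt.
apply: nw; apply: ac => //; by case: (i).
Qed.

End Balance.

(** * Koszul homology of an edge ideal *)

Section EdgeIdeal.
Variables (K : fieldType) (n : nat) (e : rel 'I_n).
Local Notation S := {mpoly K[n]}.
Implicit Types (W s t : {set 'I_n}) (m a : 'X_{1..n}) (f : S).

Definition edge_mon a := [exists x, exists y, [&& e x y, 0 < a x & 0 < a y]]%N.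

Lemma edge_monP a : reflect (exists x y, [/\ e x y,
  (0 < a x)%N & (0 < a y)%N]) (edge_mon a).
Proof.
apply: (iffP existsP) => [[x /existsP[y /and3P[? ? ?]]]|[x [y [? ? ?]]]];
  first by exists x, y.
by exists x; apply/existsP; exists y; apply/and3P.
Qed.

Lemma edge_ideal0 : edge_ideal e (0 : S).
Proof.
by exists (fun _ _ => 0); rewrite big1 // => x _; rewrite big1 // => y _; rewrite mul0r.
Qed.

Lemma edge_idealD f h : edge_ideal e f -> edge_ideal e h -> edge_ideal e (f + h).
Proof.
move=> [c ->] [d ->]; exists (fun x y => c x y + d x y); rewrite -big_split.
apply: eq_bigr => x _; rewrite -big_split; apply: eq_bigr => y _; by rewrite mulrDl.
Qed.

Hypothesis e_irr : irreflexive e.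

Lemma edge_idealP f : edge_ideal e f <-> forall a, f@_a != 0 -> edge_mon a.
Proof.
split=> [[c ->] a|fa].
  rewrite raddf_sum => nz; apply/edge_monP.
  have [x _ {}nz] : exists2 x, x \in 'I_n & 
      mcoeff a (\sum_(y < n | e x y) c x y * ('X_x * 'X_y)) != 0.
    by apply/exists_inP; apply: contraNT nz => /exists_inPn h; apply/eqP/big1 => x _;
      apply/eqP/negPn/h.
  rewrite raddf_sum in nz.
  have [y exy {}nz] : exists2 y, e x y & mcoeff a (c x y * ('X_x * 'X_y)) != 0.
    by apply/exists_inP; apply: contraNT nz => /exists_inPn h; apply/eqP/big1 => y xy;
      apply/eqP/negPn/h.
  exists x, y; split=> //; move: nz; rewrite -mpolyXD mulrC mcoeffXM;
    case: ifP => [le _|]; rewrite ?eqxx //.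
    by apply: leq_trans (mnm_lepP le x); rewrite mnmDE mnm1E eqxx.
  by apply: leq_trans (mnm_lepP le y); rewrite mnmDE !mnm1E eqxx addn1.
rewrite (mpolyE f) big_seq; elim/big_ind: _ => [||a];
  [exact: edge_ideal0 | exact: edge_idealD |].
rewrite mcoeff_msupp => /fa/edge_monP[x [y [exy ax ay]]].
exists (fun x' y' => if (x' == x) && (y' == y) then f@_a *: 'X_[a - (U_(x) +
  U_(y))] else 0).
rewrite (bigD1 x) //= (bigD1 y) //= !eqxx /= -mpolyXD -scalerAl -mpolyXD submK.
  rewrite [X in _ + X + _]big1 => [|z /andP[_ /negPf ->]]; last by rewrite mul0r.
  by rewrite addr0 big1 ?addr0 // => z /negPf ->; rewrite big1 // => w _; rewrite mul0r.
(* Without loops the two variables differ, so positive exponents at both give divisibility by their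
   product. *)
apply/mnm_lepP => z; rewrite mnmDE !mnm1E.
have [xz|_] := eqVneq x z; last by have [<-|] := eqVneq y z.
by have [yz|] := eqVneq y z; [rewrite xz yz e_irr in exy | rewrite -xz].
Qed.

Definition indep t := [forall x in t, forall y in t, ~~ e x y].

Lemma indepPn t : reflect (exists x y, [/\ x \in t, y \in t & e x y]) (~~ indep t).
Proof.
apply: (iffP forall_inPn) => [[x xt /forall_inPn[y yt /negPn exy]]|[x [y [xt yt exy]]]].
  by exists x, y.
by exists x => //; apply/forall_inPn; exists y; rewrite ?exy.
Qed.

Definition rel_supp W i (p : {set 'I_n} -> K) :=
  forall s, p s != 0 -> [/\ s \subset W, #|s| = i & ~~ indep (W :\: s)].

(* The Koszul homology of the edge ideal in the squarefree multidegree [W]: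
   [s] stands for the product of the variables in [W :\: s] times e_s. *)
Definition rel_neq0 W i := exists p,
  [/\ rel_supp W i p, (forall t, t \subset W -> bd W p t = 0) &
   ~ exists q, rel_supp W i.+1 q /\ forall t, t \subset W -> bd W q t = p t].

Local Notation supp m := [set v | (kvar v <= m)%MM].

Lemma supp_lcm W : supp (lcmset (@kvar n) W) = W.
Proof. by apply/setP => v; rewrite inE kvar_le kvar_lcm; case: (v \in W). Qed.

Lemma edge_mon_lcm m W s : m = lcmset (@kvar n) W -> s \subset W ->
  edge_mon (m - lcmset (@kvar n) s)%MM = ~~ indep (W :\: s).
Proof.
move=> -> sW; apply/edge_monP/indepPn => -[x [y [h1 h2 h3]]]; exists x, y;
  move: h1 h2 h3; rewrite ?mnmBE ?kvar_lcm !inE;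
  by case: (x \in W); case: (x \in s); case: (y \in W); case: (y \in s).
Qed.

(* A multidegree divisible by the square of the variable [v] contracts along [v],
   since removing [v] from such a monomial does not affect its support. *)
Lemma koszul_mdeg_acyclic j i (b : {ffun {set 'I_n} -> 'rV[S]_1}) m :
  (forall W, j = #|W|%:Z -> ~ rel_neq0 W i) ->
  kideal (edge_ideal e) j i b -> kdiff b = 0 ->
  exists q : {set 'I_n} -> K,
   [/\ (forall s, q s != 0 -> [/\ s \subset supp m, #|s| = i.+1,
         (mdeg m)%:Z = j & edge_mon (m - lcmset (@kvar n) s)%MM]) &
       (forall t, t \subset supp m -> bd (supp m) q t = piece (@kvar n) m b ord0 t)].
Proof.
move=> noW [bc bI] db; pose p := piece (@kvar n) m b ord0.
have psupp s : p s != 0 -> [/\ s \subset supp m, #|s| = i, (mdeg m)%:Z = j &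
    edge_mon (m - lcmset (@kvar n) s)%MM].
  move=> nz; have [mj si cnz] := kchain_piece bc nz; split=> //; last first.
  - by have /edge_idealP := bI s; apply.
  - by rewrite mj subr0.
  by move: nz; rewrite /p /piece -lcmset_le; case: ifP => // _; rewrite eqxx.
have bdp t : t \subset supp m -> bd (supp m) p t = 0.
  move=> tm; rewrite -piece_taylor_bd // piece0 //.
  by have /ffunP/(_ t) := db; rewrite !ffunE.
have [mj|mj] := eqVneq (mdeg m)%:Z j; last first.
  exists (fun _ => 0); split=> [s|t _]; first by rewrite eqxx.
  rewrite /bd big1 => [|v _]; last by rewrite mulr0.
  by apply/esym/eqP; apply: contraNT mj => /psupp[_ _ ->].
have [/existsP[v v2]|sq] := boolP [exists v, 1 < m v]%N.
  have vm : v \in supp m by rewrite inE kvar_le; lia.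
  exists (htp v p); split=> [s|t tm]; last first.
    rewrite -[RHS](bd_htp _ _ vm) -[LHS]addr0; congr (_ + _); rewrite /htp.
    by case: ifP => // _; rewrite bdp ?mulr0 //; apply: subset_trans tm; exact: subD1set.
  rewrite /htp; case: ifP => [vs|_]; last by rewrite eqxx.
  rewrite mulf_eq0 negb_or => /andP[_ /psupp[sm si _ em]]; split=> //.
  - by rewrite -(setD1K vs) subUset sub1set vm.
  - by rewrite (cardsD1 v) vs si.
  case/edge_monP: em => x [y [exy x0 y0]]; apply/edge_monP; exists x, y; split=> //.
    by move: x0; rewrite !mnmBE !kvar_lcm !inE; case: eqVneq => [->|_] //=; rewrite vs;
      lia.
  by move: y0; rewrite !mnmBE !kvar_lcm !inE; case: eqVneq => [->|_] //=; rewrite vs; lia.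
set W := supp m; have mW : m = lcmset (@kvar n) W.
  apply/mnmP => x; rewrite kvar_lcm inE kvar_le; move: sq;
    rewrite negb_exists => /forallP/(_ x).
  by case: (m x) => [|[]].
have jW : j = #|W|%:Z by rewrite -mj {1}mW mdeg_kvar.
have [q [qs qb]] : exists q, rel_supp W i.+1 q /\ forall t, t \subset W -> bd W q t = p t.
  apply: contrapT => nq; apply: (noW W jW); exists p; split=> // s /psupp[sm si _ em].
  by split=> //; rewrite -(edge_mon_lcm mW).
exists q; split=> [s /qs[sW si ns]|//]; split=> //.
by rewrite (edge_mon_lcm mW).
Qed.

(** Koszul homology splits by multidegree. If every strand is exact, the preimages of all strands
    are assembled into one chain; conversely a class of the strand [W] is placed in that
    multidegree, and a preimage is restricted to it. *)
Lemma koszul_neq0_rel j i :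
  koszul_neq0 (@edge_ideal K n e) j i <-> exists W, j = #|W|%:Z /\ rel_neq0 W i.
Proof.
split=> [[b [bi db nb]]|[W [-> [p [ps pb np]]]]].
  apply: contrapT => noW; apply: nb.
  have {}noW W : j = #|W|%:Z -> ~ rel_neq0 W i by move=> jW rW; apply: noW; exists W.
  have /choice[q qP] := fun m => koszul_mdeg_acyclic m noW bi db.
  have [|w [wp wE]] := @piece_assemble K n n (@kvar n) 1 `|j|.+1 (fun m _ s => q m s).
    by move=> m _ s nz; have [/(_ s nz)[_ _ <- _] _] := qP m; lia.
  exists (finfun w); last first.
    apply/ffunP; have /(_ _) := @piece_eq K n n (@kvar n) 1 (kdiff (finfun w)) b; apply.
    move=> m c t tm; rewrite (ord1 c); have [_ /(_ t tm) <-] := qP m.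
    rewrite {1}/piece ffunE -/(piece _ m (taylor_bd (@kvar n) (finfun w)) ord0 t).
    rewrite piece_taylor_bd //; apply: eq_bd => v vm.
    by rewrite -(wp m ord0) ?subUset ?sub1set ?vm // /piece ffunE.
  split.
    apply: kchainP => [s si|m c s].
      rewrite ffunE; apply/rowP => c; apply/mpolyP => a; rewrite wE mxE mcoeff0.
      apply/eqP; apply: contraNT si => /(fun nz => (qP _).1 s nz)[_ -> _ _]; exact: eqxx.
    rewrite /piece ffunE; case: ifP => [le|_]; last by rewrite eqxx.
    by rewrite wE submK // subr0 => /(fun nz => (qP _).1 s nz)[].
  move=> s; rewrite ffunE; apply/edge_idealP => a;
    rewrite wE => /(fun nz => (qP _).1 s nz)[_ _ _].
  by rewrite addmK.
pose mW := lcmset (@kvar n) W.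
have [|w [wp wE]] := @piece_assemble K n n (@kvar n) 1 #|W|.+1
    (fun m _ s => if m == mW then p s else 0).
  by move=> m _ s; case: (eqVneq m mW) => [-> _|_]; rewrite ?eqxx // mdeg_kvar.
have wkey m c t : t \subset supp m ->
  piece (@kvar n) m (finfun w) c t = if m == mW then p t else 0.
  by move=> tm; rewrite -(wp m c) // /piece ffunE.
exists (finfun w); split.
- split.
    apply: kchainP => [s si|m c s].
      rewrite ffunE; apply/rowP => c; apply/mpolyP => a; rewrite wE mxE mcoeff0.
      by case: ifP => // _; apply/eqP; apply: contraNT si => /ps[_ -> _].
    have [sm|nsm] := boolP (s \subset supp m);
      last by rewrite /piece lcmset_le (negPf nsm) eqxx.
    by rewrite wkey //; case: (eqVneq m mW) => [->|_]; rewrite ?eqxx // mdeg_kvar subr0.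
  move=> s; rewrite ffunE; apply/edge_idealP => a; rewrite wE;
    case: ifP => [/eqP aE|_]; last by rewrite eqxx.
  by move=> /ps[sW _]; rewrite -(edge_mon_lcm (erefl mW) sW) -aE addmK.
- apply/ffunP; have /(_ _) := @piece_eq K n n (@kvar n) 1 (kdiff (finfun w)) (fun=> 0).
  move=> h s; rewrite h ?ffunE {h s} // => m c t tm; rewrite [RHS]piece0 //.
  rewrite {1}/piece ffunE -/(piece _ m (taylor_bd (@kvar n) (finfun w)) c t)
    piece_taylor_bd //.
  transitivity (bd (supp m) (fun t => if m == mW then p t else 0) t).
    by apply: eq_bd => v vm; rewrite wkey // subUset sub1set vm.
  have [mE|_] := eqVneq m mW; last by rewrite /bd big1 // => v _; rewrite mulr0.
  by move: tm; rewrite mE supp_lcm; exact: pb.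
- move=> [b' [bc bI] db]; apply: np; exists (piece (@kvar n) mW b' ord0);
  split=> [s nz|t tW].
    have [mj si cnz] := kchain_piece bc nz.
    have sW : s \subset W.
      move: nz; rewrite /piece lcmset_le supp_lcm; case: ifP => // _; by rewrite eqxx.
    split=> //; rewrite -(edge_mon_lcm (erefl mW) sW).
    by have /edge_idealP := bI s; apply.
  rewrite -{1}(supp_lcm W) -piece_taylor_bd ?supp_lcm //.
  have := wkey mW ord0 t; rewrite eqxx supp_lcm => /(_ tW) <-.
  by rewrite -db /piece ffunE.
Qed.

End EdgeIdeal.

(** * Cohomology of the independence complex *)

Section Cohomology.
Variables (K : fieldType) (n : nat) (e : rel 'I_n).
Implicit Types (u v : 'I_n) (W s t r : {set 'I_n}) (a b p q : {set 'I_n} -> K).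
Local Notation indep := (indep e).

Definition cob b t : K := \sum_(v in t) sgn K v (t :\ v) * b (t :\ v).

(* Reduced cohomology in degree [k - 1] of the complex of independent sets of [e]
   contained in [W]; the values of cochains on other sets are irrelevant. *)
Definition coh_neq0 W k := exists b,
  (forall t, t \subset W -> indep t -> #|t| = k.+1 -> cob b t = 0) /\
  ~ exists a, forall t, t \subset W -> indep t -> #|t| = k -> b t = cob a t.

(* The sign for which complementation in [W] turns the Koszul differential into
   the coboundary. *)
Definition twist W t : K := \prod_(v in t) sgn K v W.

Definition dual W p t : K := twist W t * p (W :\: t).

Lemma twistK W t : twist W t * twist W t = 1.
Proof. by rewrite -big_split big1 //= => v _; exact: sgnK. Qed.

Lemma twist_neq0 W t : twist W t != 0.
Proof. by apply/eqP => w0; have /eqP := twistK W t; rewrite w0 mul0r eq_sym oner_eq0. Qed.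

Lemma dualK W p t : t \subset W -> twist W t * dual W p t = p (W :\: t).
Proof. by rewrite /dual mulrA twistK mul1r. Qed.

Lemma sgnD W t v : t \subset W -> sgn K v (W :\: t) = sgn K v W * sgn K v t.
Proof.
move=> tW; have h : sgn K v (W :\: t) * sgn K v t = sgn K v W.
  rewrite /sgn -exprD -cardsUI; congr (_ ^+ _).
  have -> : [set u in W :\: t | (u < v)%N] :&: [set u in t | (u < v)%N] = set0.
    by apply/setP => x; rewrite !inE; case: (x \in t); rewrite ?andbF.
  rewrite cards0 addn0; apply: eq_card => x; rewrite !inE -andb_orl.
  by case: (boolP (x \in t)) => [/(subsetP tW) ->|_]; rewrite ?orbT ?orbF.
by rewrite -h -mulrA sgnK mulr1.
Qed.

(** Adding [v] to [W :\: t] is removing [v] from [t]. By [sgnD] the sign factors into [sgn K v W],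
    absorbed by [twist], and the sign of the coboundary. *)
Lemma bd_dual W p t : t \subset W -> bd W p (W :\: t) = twist W t * cob (dual W p) t.
Proof.
move=> tW; rewrite /bd /cob big_distrr /= setDDr setDv set0U (setIidPr tW).
apply: eq_bigr => v vt; have vW := subsetP tW v vt.
have tvW : t :\ v \subset W by apply: subset_trans tW; exact: subD1set.
have -> : v |: (W :\: t) = W :\: (t :\ v).
  by apply/setP => x; rewrite !inE negb_and negbK; case: (eqVneq x v) => [->|].
have -> : twist W t = sgn K v W * twist W (t :\ v) by rewrite /twist (big_setD1 v).
have tv : sgn K v t = sgn K v (t :\ v).
  by rewrite -{1}(setD1K vt) sgn_setU1 ?inE ?eqxx // ltnn expr0 mul1r.
rewrite /dual sgnD // tv.
have := twistK W (t :\ v); set x := twist _ _; set y := sgn K v W; set z := sgn K v _.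
by move=> xx; transitivity (x * x * (y * z * p (W :\: (t :\ v))));
  [rewrite xx mul1r | ring].
Qed.

Definition undual W a s : K := twist W (W :\: s) * a (W :\: s).

Lemma undualK W a t : t \subset W -> dual W (undual W a) t = a t.
Proof.
by move=> tW; rewrite /dual /undual setDDr setDv set0U (setIidPr tW) mulrA twistK mul1r.
Qed.

Lemma eq_cob a b t : (forall v, v \in t -> a (t :\ v) = b (t :\ v)) -> cob a t = cob b t.
Proof. by move=> e'; apply: eq_bigr => v vt; rewrite e'. Qed.

Lemma eq_bd_card W p q k t : (forall s, s \subset W -> #|s| = k.+1 -> p s = q s) ->
  t \subset W -> #|t| = k -> bd W p t = bd W q t.
Proof.
move=> pq tW tk; apply: eq_bigr => v; rewrite inE => /andP[vt vW].
by rewrite pq ?subUset ?sub1set ?vW // cardsU1 vt tk.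
Qed.

Lemma bd_supp_card W p k t : (forall s, #|s| != k.+1 -> p s = 0) -> #|t| != k ->
  bd W p t = 0.
Proof.
move=> h tk; rewrite /bd big1 // => v; rewrite inE => /andP[vt _].
by rewrite h ?mulr0 // cardsU1 vt.
Qed.

Lemma bdB W p q t : bd W (fun s => p s - q s) t = bd W p t - bd W q t.
Proof. by rewrite /bd -sumrB; apply: eq_bigr => v _; rewrite mulrBr. Qed.

Lemma bd_htp_cycle W v p t : v \in W -> t \subset W ->
  (forall s, s \subset W -> bd W p s = 0) -> bd W (htp v p) t = p t.
Proof.
move=> vW tW pb; rewrite -[RHS](bd_htp _ _ vW) -[LHS]addr0; congr (_ + _).
rewrite /htp; case: ifP => // _; rewrite pb ?mulr0 //.
by apply: subset_trans tW; exact: subD1set.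
Qed.

Lemma indepN0 t : ~~ indep t -> t != set0.
Proof. by move/indepPn => [x [y [xt _ _]]]; apply/set0Pn; exists x. Qed.

Lemma card_setDsub W t : t \subset W -> (#|W :\: t| + #|t| = #|W|)%N.
Proof. by move=> tW; rewrite cardsD (setIidPr tW) subnK // subset_leq_card. Qed.

(** The connecting map of the pair formed by the ideal inside the polynomial ring, whose strand on
    the nonempty [W] is contractible. The cycle [p] bounds [h] there; since [p] lives off the
    complements of independent sets, the dual of [h] is a cocycle on them. *)
Lemma rel_neq0_coh W i : rel_neq0 K e W i ->
  exists k, #|W| = (i + k.+1)%N /\ coh_neq0 W k.
Proof.
move=> [p [ps pb np]].
have [s0 ps0] : exists s, p s != 0.
  apply: contrapT => h; apply: np; exists (fun _ => 0); split=> [s|t _];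
    first by rewrite eqxx.
  rewrite /bd big1 => [|v _]; last by rewrite mulr0.
  by apply/esym/eqP; apply: contrapT => /negP h'; apply: h; exists t.
have [s0W s0i /indepN0 W0] := ps _ ps0.
have [v vW] : exists v, v \in W by case/set0Pn: W0 => v; rewrite inE => /andP[_];
  exists v.
have Wi : (i < #|W|)%N.
  by rewrite -(card_setDsub s0W) s0i -[ltnLHS]add0n ltn_add2r card_gt0.
exists (#|W| - i.+1)%N; set k := (_ - _)%N; split; first by lia.
pose h := htp v p.
have hE t : t \subset W -> bd W h t = p t by move=> tW; exact: bd_htp_cycle.
exists (dual W h); split=> [t tW ti tk|[a aE]].
  apply: (mulfI (twist_neq0 W t)).
  rewrite mulr0 -bd_dual // hE ?subsetDl //; apply/eqP; apply: contraTT ti => /ps[_ _].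
  by rewrite setDDr setDv set0U (setIidPr tW).
pose al := undual W a.
(* If the dual of [h] is a coboundary, correcting [h] by the boundary of [al] gives a preimage of
   [p] within the ideal. *)
pose q s := if [&& s \subset W,
  #|s| == i.+1 & ~~ indep (W :\: s)] then h s - bd W al s else 0.
have qE s : s \subset W -> #|s| = i.+1 -> q s = h s - bd W al s.
  move=> sW si; rewrite /q sW si eqxx /=; case: (boolP (indep _)) => //= ti.
  set t := W :\: s in ti *; have tW : t \subset W by exact: subsetDl.
  have sE : s = W :\: t by rewrite /t setDDr setDv set0U (setIidPr sW).
  rewrite sE bd_dual // -dualK // -mulrBr aE //; last by have := card_setDsub sW;
    rewrite -/t; lia.
  rewrite (@eq_cob (dual W al) a) ?subrr ?mulr0 // => x _.
  by rewrite undualK //; apply: subset_trans tW; exact: subD1set.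
apply: np; exists q; split=> [s|t tW].
  by rewrite /q; case: ifP => [/and3P[? /eqP ? ?]|]; rewrite ?eqxx.
have [/eqP ti|ti] := boolP (#|t| == i).
  by rewrite (eq_bd_card qE tW ti) bdB bd_bd subr0 hE.
rewrite (@bd_supp_card _ _ i) //; last first.
  by move=> s /negPf si; rewrite /q si andbF.
by apply/esym/eqP; apply: contraNT ti => /ps[_ -> _].
Qed.

(** The inverse of the connecting map: a cocycle is dualized to [be], whose boundary lies in the
    ideal by the cocycle condition. *)
Lemma coh_rel_neq0 W i k : #|W| = (i + k.+1)%N -> coh_neq0 W k -> rel_neq0 K e W i.
Proof.
move=> Wik [b [bc nb]].
have [v vW] : exists v, v \in W by apply/card_gt0P; rewrite Wik addnS.
pose be := undual W b.
pose p t := if (t \subset W) && (#|t| == i) then bd W be t else 0.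
have pbd t : t \subset W -> #|t| = i -> p t = bd W be t by rewrite /p => -> ->;
  rewrite eqxx.
exists p; split=> [t|t tW|[q [qs qE]]].
- rewrite /p; case: ifP => [/andP[tW /eqP ti] nz|]; last by rewrite eqxx.
  split=> //; apply: contraNN nz => it; set s := W :\: t in it.
  have sW : s \subset W by exact: subsetDl.
  have tE : t = W :\: s by rewrite /s setDDr setDv set0U (setIidPr tW).
  rewrite tE bd_dual // (@eq_cob _ b) => [|x _].
    by rewrite bc ?mulr0 //; have := card_setDsub tW; rewrite -/s; lia.
  by rewrite undualK //; apply: subset_trans sW; exact: subD1set.
- have [ti|ti] := eqVneq #|t|.+1 i.
    rewrite (@eq_bd_card W p (bd W be) #|t|) ?bd_bd // => s sW st.
    by rewrite pbd // st.
  rewrite /bd big1 // => x; rewrite inE => /andP[xt _].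
  by rewrite /p cardsU1 xt add1n (negPf ti) andbF mulr0.
(* If that boundary is also the boundary of some [q] in the ideal, then [be - q] is a cycle of the
   full simplex. It bounds [htp v ga], and the dual of [htp v ga] is a primitive of [b]. *)
pose ga s := if (s \subset W) && (#|s| == i.+1) then be s - q s else 0.
have gab t : t \subset W -> bd W ga t = 0.
  move=> tW; have [/eqP ti|ti] := boolP (#|t| == i); last first.
    by apply: bd_supp_card ti => s /negPf si; rewrite /ga si andbF.
  rewrite (@eq_bd_card W ga (fun s => be s - q s) i) //.
    by rewrite bdB qE // pbd // subrr.
  by move=> s sW si; rewrite /ga sW si eqxx.
apply: nb; exists (dual W (htp v ga)) => t tW ti tk.
rewrite -(undualK b tW) /dual -/be.
have sW : W :\: t \subset W by exact: subsetDl.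
have si : #|W :\: t| = i.+1 by have := card_setDsub tW; lia.
have -> : be (W :\: t) = bd W (htp v ga) (W :\: t).
  rewrite bd_htp_cycle // /ga sW si eqxx /=.
  suff -> : q (W :\: t) = 0 by rewrite subr0.
  apply/eqP; apply: contraTT ti => /qs[_ _].
  by rewrite setDDr setDv set0U (setIidPr tW).
by rewrite bd_dual // mulrA twistK mul1r.
Qed.

(** * Coboundaries, links and cones *)

Lemma cobB a b t : cob (fun s => a s - b s) t = cob a t - cob b t.
Proof. by rewrite /cob -sumrB; apply: eq_bigr => v _; rewrite mulrBr. Qed.

Lemma cob_cob b t : cob (cob b) t = 0.
Proof.
have cobE a s : cob a s = dual setT (bd setT (undual setT a)) s.
  rewrite /dual bd_dual ?subsetT // mulrA twistK mul1r.
  by apply: eq_cob => v _; rewrite undualK ?subsetT.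
rewrite (eq_cob (fun v _ => cobE b (t :\ v))) cobE /dual.
rewrite (_ : bd _ _ _ = bd setT (bd setT (undual setT b)) (setT :\: t)).
  by rewrite bd_bd mulr0.
apply: eq_bigr => v _; congr (_ * _).
by rewrite /undual /dual setDDr setDv set0U (setIidPr (subsetT _)) mulrA twistK mul1r.
Qed.

Lemma cobU1 v t b : v \notin t ->
  cob b (v |: t) = sgn K v t * b t +
    \sum_(u in t) sgn K u (v |: (t :\ u)) * b (v |: (t :\ u)).
Proof.
move=> vt; rewrite /cob big_setU1 //= setU1K //; congr (_ + _).
apply: eq_bigr => u ut; have -> // : (v |: t) :\ u = v |: (t :\ u).
have vu : v != u by apply: contraNneq vt => ->.
by apply/setP => x; rewrite !inE; case: (eqVneq x v) => [->|_] //=; rewrite vu.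
Qed.

Lemma sgn_face u v t : u \in t -> v \notin t ->
  sgn K v t * sgn K u (v |: (t :\ u)) = - (sgn K u (t :\ u) * sgn K v (t :\ u)).
Proof.
move=> ut vt; rewrite -sgn_swap ?inE ?eqxx ?(negPf vt) ?andbF //.
  by rewrite setD1K // mulrC.
by apply: contraNneq vt => <-.
Qed.

(** Places a cochain of the link of [v] on the sets containing [v]. *)
Definition coneop v a t : K := if v \in t then sgn K v (t :\ v) * a (t :\ v) else 0.

Lemma cob_coneop v a t : v \notin t ->
  cob (coneop v a) (v |: t) = - (sgn K v t * cob a t).
Proof.
move=> vt; rewrite cobU1 // /coneop (negPf vt) mulr0 add0r /cob big_distrr /= -sumrN.
apply: eq_bigr => u ut; rewrite setU11 setU1K ?inE ?(negPf vt) ?andbF // mulrA.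
have := sgn_face ut vt; have := sgnK K v t; have := sgnK K v (t :\ u).
set x := sgn K v t; set y := sgn K u _; set z := sgn K u _;
  set w := sgn K v _ => ww xx eq1.
transitivity ((x * x) * (y * w) * a (t :\ u)); first by rewrite xx mul1r.
transitivity (x * (x * y) * w * a (t :\ u)); first by ring.
rewrite eq1; transitivity (- (x * (z * (w * w) * a (t :\ u)))); first by ring.
by rewrite ww mulr1.
Qed.

Lemma cob_coneop0 v a t : v \notin t -> cob (coneop v a) t = 0.
Proof.
by move=> vt; rewrite /cob big1 // => u _; rewrite /coneop inE (negPf vt) andbF mulr0.
Qed.

Hypotheses (e_sym : symmetric e) (e_irr : irreflexive e).

Lemma indepP t : reflect {in t &, forall x y, ~~ e x y} (indep t).
Proof.
apply: (iffP forall_inP) => [h x y xt yt|h x xt]; first by have /forall_inP := h x xt;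
  apply.
by apply/forall_inP => y; exact: h.
Qed.

Lemma indepU1 v t : indep (v |: t) = indep t && [forall u in t, ~~ e u v].
Proof.
apply/indepP/andP => [h|[/indepP h /forall_inP hv] x y].
  split; first by apply/indepP => x y xt yt; apply: h; rewrite !inE ?xt ?yt orbT.
  by apply/forall_inP => u ut; apply: h; rewrite !inE ?ut ?eqxx ?orbT.
rewrite !inE => /predU1P[->|xt] /predU1P[->|yt]; rewrite ?e_irr //.
- by rewrite e_sym hv.
- exact: hv.
- exact: h.
Qed.

Definition nbs v W := [set u in W | (u != v) && ~~ e u v].

(* The long exact sequence of the pair (complex, deletion of [v]). *)
Lemma coh_link W v k : v \in W -> coh_neq0 W k.+1 ->
  coh_neq0 (W :\ v) k.+1 \/ coh_neq0 (nbs v W) k.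
Proof.
move=> vW [b [bc nb]]; have [|nd] := pselect (coh_neq0 (W :\ v) k.+1); first by left.
have [|nl] := pselect (coh_neq0 (nbs v W) k); first by right.
exfalso; apply: nb.
have [a aE] : exists a, forall t, t \subset W :\ v -> indep t -> #|t| = k.+1 ->
  b t = cob a t.
  apply: contrapT => h; apply: nd; exists b; split=> // t tW; apply: bc.
  by apply: subset_trans tW _; exact: subD1set.
(* Extending [a] by zero to the sets containing [v] and subtracting its coboundary makes the cocycle
   vanish on the deletion; what is left is the cochain [be] on the link. *)
pose a' t := if v \in t then 0 else a t.
pose b1 t := b t - cob a' t.
have b10 t : t \subset W :\ v -> indep t -> #|t| = k.+1 -> b1 t = 0.
  move=> tW ti tk; rewrite /b1 aE // (@eq_cob a' a) ?subrr // => u _.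
  by rewrite /a' inE; have /subsetP/(_ v) := tW; rewrite !inE eqxx /= => h;
    case: (v \in t) h => [/(_ isT)|_]; rewrite ?andbF.
have b1c t : cob b1 t = cob b t by rewrite cobB cob_cob subr0.
pose be r := sgn K v r * b1 (v |: r).
have nbsP r : r \subset nbs v W -> indep r ->
  [/\ v \notin r, r \subset W :\ v, v |: r \subset W & indep (v |: r)].
  move=> /subsetP rn ri; have vr : v \notin r.
    by apply/negP => /rn; rewrite !inE eqxx andbF.
  split=> //.
  - by apply/subsetP => u /rn; rewrite !inE => /and3P[-> ->].
  - by rewrite subUset sub1set vW; apply/subsetP => u /rn; rewrite !inE => /and3P[->].
  - by rewrite indepU1 ri; apply/forall_inP => u /rn; rewrite !inE => /and3P[].
have bec r : r \subset nbs v W -> indep r -> #|r| = k.+1 -> cob be r = 0.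
  move=> rn ri rk; have [vr rW vrW vri] := nbsP r rn ri.
  (* On the faces of [v |: r] the cochains [b1] and [coneop v be] agree, so the cocycle condition
     for [b1] becomes the one for [be] at [r]. *)
  have : cob (coneop v be) (v |: r) = 0.
    rewrite -[RHS](bc _ vrW vri) ?cardsU1 ?vr ?rk // -b1c !cobU1 //.
    rewrite b10 // /coneop (negPf vr) !mulr0; congr (_ + _); apply: eq_bigr => u ur.
    rewrite setU11 setU1K ?inE ?(negPf vr) ?andbF // /be [sgn K v _ * (_ * _)]mulrA.
    by rewrite sgnK mul1r.
  rewrite cob_coneop // => /eqP; rewrite oppr_eq0 mulf_eq0 (negPf (sgn_neq0 _ _ _)) =>
    /eqP //.
have [al alE] : exists al, forall r, r \subset nbs v W -> indep r -> #|r| = k ->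
  be r = cob al r.
  by apply: contrapT => h; apply: nl; exists be.
exists (fun t => a' t - coneop v al t) => t tW ti tk; rewrite cobB.
have [vt|vt] := boolP (v \in t); last first.
  rewrite cob_coneop0 // subr0; apply/eqP; rewrite -subr_eq0 -/(b1 t) b10 //.
  by rewrite subsetD1 tW.
set r := t :\ v; have tE : t = v |: r by rewrite setD1K.
have vr : v \notin r by rewrite !inE eqxx.
move: ti; rewrite tE indepU1 => /andP[ri /forall_inP rv].
have rn : r \subset nbs v W.
  apply/subsetP => u ur; rewrite inE rv // andbT; move: ur; rewrite !inE => /andP[-> ut].
  by rewrite (subsetP tW).
rewrite cob_coneop // opprK -alE //; last by move: tk; rewrite tE cardsU1 vr => -[].
by rewrite /be mulrA sgnK mul1r /b1 addrC subrK.
Qed.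

(** The complex is a cone with apex [v]; a primitive is obtained by evaluating the cocycle after
    joining [v]. *)
Lemma coh_cone W v k : v \in W -> (forall u, u \in W -> ~~ e u v) -> ~ coh_neq0 W k.
Proof.
move=> vW cone [b [bc nb]]; apply: nb.
exists (fun t => if v \in t then 0 else sgn K v t * b (v |: t)) => t tW ti tk.
have [vt|vt] := boolP (v \in t).
  rewrite /cob (bigD1 v) //= big1 => [|u /andP[ut uv]].
    by rewrite !inE eqxx /= setD1K // addr0 mulrA sgnK mul1r.
  by rewrite !inE eq_sym uv vt mulr0.
have vtW : v |: t \subset W by rewrite subUset sub1set vW.
have vti : indep (v |: t).
  by rewrite indepU1 ti; apply/forall_inP => u ut; apply: cone; exact: (subsetP tW).
have := bc _ vtW vti; rewrite cardsU1 vt tk cobU1 // => /(_ erefl) h.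
have {h} : sgn K v t * (sgn K v t * b t +
  \sum_(u in t) sgn K u (v |: (t :\ u)) * b (v |: (t :\ u))) = 0.
  by rewrite h mulr0.
rewrite mulrDr mulrA sgnK mul1r => /eqP; rewrite addr_eq0 => /eqP ->.
rewrite big_distrr /= -sumrN; apply: eq_bigr => u ut.
rewrite inE (negPf vt) andbF !mulrA sgn_face //; ring.
Qed.

Lemma coh_set0 k : ~ coh_neq0 set0 k.+1.
Proof.
move=> [b [_ nb]]; apply: nb; exists (fun _ => 0) => t.
by rewrite subset0 => /eqP ->; rewrite cards0.
Qed.

Lemma coh_indep Q k : indep Q -> ~ coh_neq0 Q k.+1.
Proof.
have [->|/set0Pn[v vQ] /indepP Qi] := eqVneq Q set0; first by move=> _; exact: coh_set0.
by apply: (coh_cone vQ) => u uQ; exact: (Qi u v uQ vQ).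
Qed.

Lemma cob_pair a x y : x != y ->
  cob a [set x; y] = sgn K x [set y] * (a [set y] - a [set x]).
Proof.
move=> xy; have yx : y != x by rewrite eq_sym.
rewrite (cobU1 a (t := [set y])) ?inE // big_set1 setDv setU0 mulrBr -mulNr.
have := @sgn_swap K n x y set0 xy; rewrite !inE !setU0 !sgn0 mulr1 => /(_ isT isT) h.
congr (_ + _ * _); rewrite -[LHS]mul1r -(sgnK K x [set y]) -mulrA h; ring.
Qed.

End Cohomology.

(** * Regularity of edge ideals *)

Section Main.
Variables (K : fieldType) (n : nat) (e : rel 'I_n).
Hypotheses (e_sym : symmetric e) (e_irr : irreflexive e).
Implicit Types (W t : {set 'I_n}).

Definition coedge : rel 'I_n := fun x y => (x != y) && ~~ e x y.

Lemma coedge_sym : symmetric coedge.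
Proof. by move=> x y; rewrite /coedge eq_sym e_sym. Qed.

Lemma coedge_irr : irreflexive coedge.
Proof. by move=> x; rewrite /coedge eqxx. Qed.

Lemma clique_indep t : clique coedge t = indep e t.
Proof.
apply/cliqueP/indepP => ht x y xt yt; last by move=> xy; rewrite /coedge xy ht.
by have [->|xy] := eqVneq x y; [rewrite e_irr | have /andP[] := ht x y xt yt xy].
Qed.

(** The indicator of the closing edge is a cocycle, as there are no triangles. A primitive would be
    constant along the other edges, hence equal at the two ends of the closing edge, where the
    coboundary has to be 1. *)
Lemma coh_hole x0 c : hole coedge x0 c -> coh_neq0 K e [set x in c] 2.
Proof.
move=> hc; have [cu c4 _] := hc; have hadj := hole_adj coedge_sym hc.
set m := size c in c4 hadj; pose w i := nth x0 c i.
have wc i : (i < m)%N -> w i \in [set x in c] by move=> im; rewrite inE mem_nth.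
have wi i j : (i < m)%N -> (j < m)%N -> (w i == w j) = (i == j).
  by move=> im jm; rewrite nth_uniq.
pose t0 := [set w 0%N; w m.-1].
have pair i j : (i < m)%N -> (j < m)%N -> i != j -> cyc_adj m i j ->
    [/\ w i != w j, [set w i; w j] \subset [set x in c], indep e [set w i;
      w j] & #|[set w i; w j]| = 2%N].
  move=> im jm ij aij; have wij : w i != w j by rewrite wi.
  split=> //; first by rewrite subUset !sub1set !wc.
    rewrite -clique_indep; apply/cliqueP => x y; rewrite !inE.
    have hij : coedge (w i) (w j) by rewrite hadj.
    by move=> /orP[]/eqP-> /orP[]/eqP->; rewrite ?eqxx // coedge_sym.
  by rewrite cards2 wij.
exists (fun t => (t == t0)%:R); split=> [t tc ti t3|[a aE]].
  have /cliqueP tq : clique coedge t by rewrite clique_indep.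
  by have := hole_clique coedge_sym hc tq; rewrite (setIidPl tc) t3.
have step i : (i.+1 < m)%N -> a [set w i] = a [set w i.+1].
  move=> im; have [||||wij sub ind c2] := @pair i i.+1;
    rewrite ?neq_ltn ?ltnSn ?/cyc_adj ?eqxx ?(ltnW im) //.
  have := aE _ sub ind c2; rewrite cob_pair // (_ : (_ == t0) = false).
    by move=> /esym/eqP; rewrite mulf_eq0 subr_eq0 (negPf (sgn_neq0 _ _ _)) => /eqP ->.
  apply/negP => /eqP/setP eqt; have := eqt (w i); have := eqt (w i.+1).
  rewrite !inE !eqxx orbT /= => /esym/orP[] /eqP/eqP; rewrite wi; try lia.
  move=> /eqP im1 /esym/orP[] /eqP/eqP; rewrite wi; lia.
have all0 i : (i < m)%N -> a [set w i] = a [set w 0%N].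
  by elim: i => // i IHi im; rewrite -step // IHi // ltnW.
have [||||wij sub ind c2] := @pair 0%N m.-1; try by rewrite /cyc_adj; lia.
have := aE _ sub ind c2; rewrite cob_pair // eqxx all0; last lia.
by rewrite subrr mulr0 => /eqP; rewrite oner_eq0.
Qed.

(** Without a hole there is a simplicial vertex. Its link is a simplex or empty and carries no
    cohomology in the degree required, so the vertex can be deleted. *)
Lemma coh_has_hole W i : coh_neq0 K e W i.+2 ->
  exists x0 c, hole coedge x0 c /\ {subset c <= W}.
Proof.
have [d] := ubnP #|W|; elim: d W => // d IHd W Wd AW.
have W0 : W != set0 by apply: contra_notN (@coh_set0 K n e i.+1) => /eqP <-.
have [//|[v vW vc]] := simplicial_or_hole coedge_sym coedge_irr W0.
have [Av|Av] := coh_link e_sym e_irr vW AW.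
  have [|x0 [c [hc cW]]] := IHd (W :\ v) _ Av;
    first by rewrite (cardsD1 v W) vW add1n ltnS in Wd.
  by exists x0, c; split=> // x /cW; rewrite inE => /andP[].
by case: (coh_indep e_sym e_irr _ Av); rewrite -clique_indep.
Qed.

Lemma coh0 W : W != set0 -> ~ coh_neq0 K e W 0.
Proof.
move=> /set0Pn[v vW] [b [bc nb]]; apply: nb; exists (fun _ => 0) => t _ _ /eqP.
rewrite cards_eq0 => /eqP ->; rewrite /cob big_set0.
have := bc [set v]; rewrite sub1set vW cards1 /cob big_set1 setDv.
have -> : indep e [set v].
  by apply/indepP => x y; rewrite !inE => /eqP -> /eqP ->; rewrite e_irr.
by move=> /(_ isT isT erefl) /eqP; rewrite mulf_eq0 (negPf (sgn_neq0 _ _ _)) => /eqP.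
Qed.

(** Ordered pairs, so each edge monomial is listed twice; the Taylor resolution allows repeated
    generators. *)
Let edges : {set 'I_n * 'I_n} := [set p | e p.1 p.2].
Let gen (v : 'I_#|edges|) : 'X_{1..n} := (U_((enum_val v).1) + U_((enum_val v).2))%MM.

Lemma edge_ideal_gen (f : {mpoly K[n]}) : edge_ideal e f <->
  exists c : 'I_#|edges| -> {mpoly K[n]}, f = \sum_v c v * 'X_[gen v].
Proof.
have sumE (F : 'I_n * 'I_n -> {mpoly K[n]}) :
    \sum_(x < n) \sum_(y < n | e x y) F (x, y) = \sum_(p in edges) F p.
  rewrite pair_big_dep /=; apply: eq_big => [[x y]|[x y] _] //=; by rewrite inE.
split=> [[c ->]|[c ->]].
  exists (fun v => c (enum_val v).1 (enum_val v).2).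
  rewrite (sumE (fun p => c p.1 p.2 * ('X_p.1 * 'X_p.2))) big_enum_val.
  by apply: eq_bigr => v _; rewrite mpolyXD.
exists (fun x y => \sum_(v | enum_val v == (x, y)) c v).
rewrite (sumE (fun p => (\sum_(v | enum_val v == p) c v) * ('X_p.1 * 'X_p.2))).
rewrite (partition_big enum_val (mem edges)) /=; last by move=> v _; exact: enum_valP.
by apply: eq_bigr => p _; rewrite mulr_suml; apply: eq_bigr => v /eqP <-; rewrite mpolyXD.
Qed.

(** Hochster's formula: cohomology in reduced degree [l] contributes [j - i = l + 2]. Reduced degree
    -1 is excluded by [coh0]. *)
Lemma tor_neq0P i j : tor_neq0 (@edge_ideal K n e) i j <->
  exists W l, [/\ j = #|W|%:Z, #|W| = (i + l.+2)%N & coh_neq0 K e W l.+1].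
Proof.
split=> [[F /homology_neq0_koszul/(koszul_neq0_rel K e_irr _ _)[W [jW /rel_neq0_coh[k
  [Wk AW]]]]]|].
  case: k Wk AW => [|l] Wk AW; last by exists W, l.
  by case: (coh0 _ AW); rewrite -card_gt0 Wk addn1.
move=> [W [l [jW Wl AW]]]; exists (taylor_resolution edge_ideal_gen).
apply/homology_neq0_koszul/(koszul_neq0_rel K e_irr _ _); exists W; split=> //.
exact: coh_rel_neq0 Wl AW.
Qed.

(** The independent subsets of an edge form two isolated points, with cohomology in reduced degree
    0. This makes the set of degrees in the regularity nonempty. *)
Lemma tor_edge x y : e x y -> tor_neq0 (@edge_ideal K n e) 0 2.
Proof.
move=> exy; have xy : x != y by apply: contraTneq exy => ->; rewrite e_irr.
apply/tor_neq0P; exists [set x; y], 0%N; rewrite cards2 xy; split=> //.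
exists (fun t => (t == [set x])%:R); split=> [t txy ti t2|[a aE]].
  suff tE : t = [set x; y].
    by move/indepP: ti => /(_ x y); rewrite tE !inE !eqxx orbT exy => /(_ isT isT).
  by apply/eqP; rewrite eqEcard txy cards2 xy t2.
have ind z : indep e [set z].
  by apply/indepP => u w; rewrite !inE => /eqP -> /eqP ->; rewrite e_irr.
have cobE z : cob a [set z] = a set0 by rewrite /cob big_set1 setDv sgn0 mul1r.
have := aE [set x]; rewrite sub1set !inE eqxx cards1 cobE => /(_ isT (ind x) erefl) ax.
have := aE [set y]; rewrite sub1set !inE eqxx orbT cards1 cobE -ax =>
  /(_ isT (ind y) erefl).
by rewrite eqxx (inj_eq set1_inj) eq_sym (negPf xy) => /eqP; rewrite eq_sym oner_eq0.
Qed.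

Section Bound.
Variables (R : realType) (k : nat).
Hypotheses (k_ge1 : (1 <= k)%N) (e_lin : steps_linear K e k).

(** A hole of length [m] gives a nonzero [Tor] in homological degree [m - 3 >= 1] and internal
    degree [m], off the linear strand; hence [m - 3 > k]. *)
Lemma linear_hole_size x0 c : hole coedge x0 c -> (k + 4 <= size c)%N.
Proof.
move=> hc; have [cu c4 _] := hc; rewrite leqNgt; apply/negP => ck.
have cE : #|[set x in c]| = size c by rewrite cardsE (card_uniqP cu).
have := @e_lin (size c - 3)%N _ (size c)%:Z; apply; [lia | lia |].
by apply/tor_neq0P; exists [set x in c], 1%N; rewrite cE; split=> //;
  [lia | exact: coh_hole hc].
Qed.

Lemma coh_size W s : coh_neq0 K e W s.+1 ->
  1 + \sum_(j < s) k.+1%:R * ((k%:R + 4) / 2) ^+ j <= n%:R :> R.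
Proof.
move=> AW; apply: le_trans (_ : #|W|%:R <= _); last first.
  by rewrite ler_nat -[leqRHS]card_ord max_card.
apply: (@size_bound R n k coedge (coh_neq0 K e)) AW => //.
- exact: coedge_sym.
- exact: coedge_irr.
- exact: linear_hole_size.
- by move=> V i AV; apply: contra_notN (@coh_set0 K n e i) => /eqP <-.
- by move=> V i /coh_has_hole.
- by move=> V v i vV /(coh_link e_sym e_irr vV).
Qed.

End Bound.
End Main.

Theorem theorem4p8 (R : realType) (K : fieldType) (k n : nat) (e : rel 'I_n)
    (k_ge1 : (1 <= k)%N) (e_sym : symmetric e) (e_irr : irreflexive e)
    (e_lin : steps_linear K e k) :
  exists2 r : int, edge_ideal_reg K e r &
    r%:~R <= logb ((k%:R + 4) / 2)
                  ((n%:R - 1) * ln ((k%:R + 4) / 2) / (k%:R + 1)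
                   + 2 / (k%:R + 4)) + 3 :> R.
Proof.
rewrite /edge_ideal_reg; case: (boolP [exists x, exists y, e x y]) =>
  [/existsP[x /existsP[y exy]]|_]; last first.
  (* Without edges the regularity is 2, which for [n >= 1] is the numerical bound at [s = 0]. *)
  exists 2 => //; case: n e e_sym e_irr e_lin => [|n'] e' _ _ _.
    exact: logb_bound_no_vertex.
  have := @logb_bound R k n'.+1 0 k_ge1; rewrite big_ord0 addr0 add0r; apply.
  by rewrite ler1n.
(* By [tor_neq0P] every difference [j - m] has the form [r + 2] with [r] a natural number at most
   [n], so a maximum exists. *)
pose P r := `[< exists m j, tor_neq0 (@edge_ideal K n e) m j /\ (r.+2)%:Z = j - m%:Z >].
have exP : exists r, P r.
  by exists 0%N; apply/asboolP; exists 0%N, 2; split=> //; exact: tor_edge exy.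
have torP m j : tor_neq0 (@edge_ideal K n e) m j -> exists2 r, P r & j - m%:Z = r.+2%:Z.
  move=> tmj; have [W [l [jW Wl _]]] := (tor_neq0P K e_irr m j).1 tmj.
  exists l; last lia.
  by apply/asboolP; exists m, j; split=> //; lia.
have ubP r : P r -> (r <= n)%N.
  move=> /asboolP[m [j [/(tor_neq0P K e_irr)[W [l [jW Wl _]]] rmj]]].
  have : (#|W| <= n)%N by rewrite -[leqRHS]card_ord max_card.
  lia.
case: (ex_maxnP exP ubP) => r /asboolP[m [j [tmj rmj]]] rmax.
exists r.+2%:Z.
  split; first by exists m, j.
  by move=> m' j' /torP[r' /rmax r'r ->]; rewrite lez_nat.
have [W [l [jW Wl AW]]] := (tor_neq0P K e_irr m j).1 tmj.
have lr : l = r by lia.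
have := logb_bound k_ge1 (coh_size e_sym e_irr R k_ge1 e_lin AW).
by rewrite lr -[r.+2]addn2 PoszD intrD.
Qed.
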